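(* Let $A\ge1$, $\gamma>1$, $\delta\ge 0$ and $\epsilon\in[0,1)$. There exists a constant $C_1=C_1(A,\gamma,\delta,\epsilon)>0$, depending only on these parameters, such that the following holds. Let $0\le T_1<T_2\le\infty$, let $x_1,x_2\in\mathbb V$, and let $f_1,f_2:\mathbb R_+\to\mathbb R_+$ satisfy $\mathbb P_{x_i}(X_t=x_i)\le 1/f_i(t)$ for all $t\ge0$, $i=1,2$. If each $f_i$ is $(A,\gamma)$-regular on $[T_1,T_2)$ and satisfies $$f_i(t)\le A e^{\delta t^{\epsilon}}\qquad\text{for all } t\in[T_1,T_2),$$ then for each $t\in[\widetilde T_1,T_2)$ with $t>0$, $$\mathbb P_{x_1}(X_t=x_2)\le\frac{C_1(\nu_{x_2}/\nu_{x_1})^{1/2}}{\sqrt{f_1\left(\frac{t}{2\gamma}\right)f_2\left(\frac{t}{2\gamma}\right)}}\exp\left(-\theta\,\frac{d_\nu(x_1,x_2)^2}{t}\right),$$ where $\theta=10^{-7}$ and $\widetilde T_1=\max\{2^9\delta\,T_1^{1+\epsilon},\ d_\nu(x_1,x_2)\}$.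
   Context: $\mathbb R_+=[0,\infty)$; $0^0=1$. $\Gamma=(\mathbb V,\mathbb E)$ is a connected, locally finite graph (finite or infinite) without double edges; $x\sim y$ means $(x,y)\in\mathbb E$. $\mu$ is an edge weight: $\mu_{xy}=\mu_{yx}>0$ if $(x,y)\in\mathbb E$ and $\mu_{xy}=0$ otherwise. $\nu_x>0$ is given for each $x\in\mathbb V$. $X=(X_t)_{t\ge0}$ is the (minimal, i.e. killed at explosion) continuous time random walk on $\mathbb V$ with generator $\mathscr L f(x)=\frac1{\nu_x}\sum_{y\in\mathbb V}(f(y)-f(x))\mu_{xy}$, and $\mathbb P_x$ is its law when started from $x$. $d_\nu$ is a metric on $\mathbb V$ such that $\frac1{\nu_x}\sum_y d_\nu(x,y)^2\mu_{xy}\le 1$ for all $x\in\mathbb V$, and $d_\nu(x,y)\le 1$ whenever $x\sim y$. A function $f:\mathbb R_+\to\mathbb R_+$ is $(A,\gamma)$-regular on $[a,b)$ if it is non-decreasing on all of $\mathbb R_+$ and $\frac{f(\gamma s)}{f(s)}\le A\frac{f(\gamma t)}{f(t)}$ for all $a\le s<t<\gamma^{-1}b$. Conventions: $f$ is positive on $(0,\infty)$; $1/0=+\infty$; if $f(0)=0$, the inequality with $s=0$ is read in cross-multiplied form $f(\gamma s)f(t)\le A f(\gamma t)f(s)$. *)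

(* Defs.v *)
From HB Require Import structures.
From mathcomp Require Import all_boot all_order all_algebra.
From mathcomp Require Import all_classical all_reals all_analysis.

Set Implicit Arguments.
Unset Strict Implicit.
Unset Printing Implicit Defensive.

Import Order.TTheory GRing.Theory Num.Theory.
Import numFieldNormedType.Exports.

Local Open Scope classical_set_scope.
Local Open Scope ring_scope.

(* An undirected graph with at most one edge between two vertices is a
   symmetric relation; loops are not excluded. *)
Record graph (V : choiceType) (E : rel V) : Prop := Graph {
  graph_sym : symmetric E;
  graph_connected : forall x y, exists2 p, path E x p & last x p = y;
  graph_locally_finite : forall x, finite_set [set y | E x y] }.

Record edge_weight (R : realType) (V : choiceType) (E : rel V)
    (mu : V -> V -> R) : Prop := EdgeWeight {
  edge_weight_sym : forall x y, mu x y = mu y x;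
  edge_weight_gt0 : forall x y, E x y -> 0 < mu x y;
  edge_weight_eq0 : forall x y, ~~ E x y -> mu x y = 0 }.

(* The sums over V below are finite-support sums; their supports are finite
   when the graph is locally finite. *)
Definition generator (R : realType) (V : choiceType) (nu : V -> R)
    (mu : V -> V -> R) (f : V -> R) (x : V) : R :=
  (nu x)^-1 * \sum_(y \in [set: V]) ((f y - f x) * mu x y).

Record is_metric (R : realType) (V : choiceType) (d : V -> V -> R) : Prop :=
  IsMetric {
  metric_ge0 : forall x y, 0 <= d x y;
  metric_eq0 : forall x y, d x y = 0 <-> x = y;
  metric_sym : forall x y, d x y = d y x;
  metric_triangle : forall x y z, d x z <= d x y + d y z }.

Record adapted_metric (R : realType) (V : choiceType) (E : rel V)
    (nu : V -> R) (mu : V -> V -> R) (d : V -> V -> R) : Prop :=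
  AdaptedMetric {
  adapted_is_metric : is_metric d;
  adapted_sum : forall x,
    (nu x)^-1 * \sum_(y \in [set: V]) (d x y ^+ 2 * mu x y) <= 1;
  adapted_jump : forall x y, E x y -> d x y <= 1 }.

Section continuous_time_walk.
Context (R : realType) (V : choiceType) (nu : V -> R) (mu : V -> V -> R).

(* The Q-matrix of the generator: q x y = (L 1_y)(x), and the total jump rate
   out of x is - q x x. *)
Definition rate (x y : V) : R := generator nu mu (fun z => (z == y)%:R) x.
Definition exit_rate (x : V) : R := - rate x x.

(* Transition matrix of the embedded jump chain; a vertex with zero exit rate
   is absorbing. *)
Definition jump_prob (x y : V) : R :=
  if exit_rate x == 0 then (x == y)%:R
  else if x == y then 0 else rate x y / exit_rate x.

Context (disp : measure_display) (Om : measurableType disp).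

(* Here Y is the jump chain and H a sequence of standard exponential variables;
   the division is in \bar R, where a / 0 = +oo for a > 0, so an absorbing
   vertex is held forever. *)
Definition holding_time (Y : nat -> Om -> V) (H : nat -> Om -> R)
    (n : nat) (w : Om) : \bar R :=
  ((H n w)%:E / (exit_rate (Y n w))%:E)%E.

Definition jump_time (Y : nat -> Om -> V) (H : nat -> Om -> R)
    (n : nat) (w : Om) : \bar R :=
  (\sum_(k < n) holding_time Y H k w)%E.

(* X under the family of laws P is the minimal continuous-time Markov chain
   with the above generator: Y is a Markov chain with transition matrix
   jump_prob started from x under P x, the H k are i.i.d. standard exponential
   variables independent of Y (both facts are in minwalk_law), and X follows Y
   with successive holding times H k / exit_rate (Y k). X t w = None when
   explosion has occurred by time t. *)
Record minimal_walk_data (P : V -> probability Om R) (X : R -> Om -> option V)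
    (Y : nat -> Om -> V) (H : nat -> Om -> R) : Prop := MinimalWalkData {
  minwalk_measurable_chain :
    forall n y, measurable [set w | Y n w = y];
  minwalk_measurable_clock : forall n, measurable_fun setT (H n);
  minwalk_clock_gt0 : forall n w, 0 < H n w;
  minwalk_law : forall (x : V) (n : nat) (y : nat -> V) (B : nat -> set R),
    (forall k, measurable (B k)) ->
    P x [set w | forall k, (k <= n)%N -> Y k w = y k /\ B k (H k w)] =
    (((y 0%N == x)%:R * \prod_(k < n) jump_prob (y k) (y k.+1))%:E *
     \prod_(k < n.+1) exponential_prob 1%R (B k))%E;
  minwalk_path : forall (t : R) (w : Om) (y : V), 0 <= t ->
    X t w = Some y <->
    exists n, [/\ (jump_time Y H n w <= t%:E)%E,
                  (t%:E < jump_time Y H n.+1 w)%E & Y n w = y] }.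

Definition minimal_walk (P : V -> probability Om R)
    (X : R -> Om -> option V) : Prop :=
  exists Y H, minimal_walk_data P X Y H.

End continuous_time_walk.

(* A function from [0, +oo[ to [0, +oo[ is an f : R -> R of which only the
   values on [0, +oo[ are used. The quotient inequality with s = 0 and f 0 = 0
   holds because a / 0 = 0 in R, in agreement with its cross-multiplied form
   f (g s) * f t <= A * f (g t) * f s, which then reads 0 <= 0. *)
Record regular (R : realType) (A g a : R) (b : \bar R) (f : R -> R) : Prop :=
  Regular {
  regular_ge0 : forall s, 0 <= s -> 0 <= f s;
  regular_gt0 : forall s, 0 < s -> 0 < f s;
  regular_ndecr : forall s t, 0 <= s -> s <= t -> f s <= f t;
  regular_ratio : forall s t, a <= s -> s < t -> (t%:E < g^-1%:E * b)%E ->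
    f (g * s) / f s <= A * (f (g * t) / f t) }.

(* Main.v *)
Require Import Defs.
From HB Require Import structures.
From mathcomp Require Import all_boot all_order all_algebra.
From mathcomp Require Import all_classical all_reals all_analysis.
From mathcomp Require Import measurable_realfun.
From mathcomp Require Import ring lra.

Set Implicit Arguments.
Unset Strict Implicit.
Unset Printing Implicit Defensive.

Import Order.TTheory GRing.Theory Num.Theory.
Import numFieldNormedType.Exports.

Local Open Scope classical_set_scope.
Local Open Scope ring_scope.

(** The walk is cut off at N jumps.  Its law at time t,
      u_t(y) = P_x (X_t = y after at most N jumps),
    has finite support, so every sum below is finite, and all estimates are
    uniform in N; the limit N -> oo is taken only at the end, by
    [walk_le_of_partial_heat].  The one fact extracted from the probabilistic
    construction is [walk_expansion]: the probability p_n(t,y) of standing at y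
    after exactly n jumps satisfies the forward equation
      p_n' (y) = \sum_z p_(n-1)(z) mu_zy / nu_z - q_y p_n(y).
    It rests on two properties of the clocks.  The clock of the n-th holding time
    is independent of the arrival time there, given the position
    ([walk_clock_independent]), and an exponential clock has no memory, so that
    during a time h the fraction 1 - exp(- q_y h) of the mass at y leaves.

    Pairing the expansions started from x and from y at times s and T - s gives a
    quantity independent of s ([expansion_convolution]): this is reversibility
    together with the semigroup property.  In particular \sum_z u_t(z)^2 / nu_z is
    at most P_x (X_2t = x) / nu_x, and P_x1 (X_t = x2) is the scalar product of
    the two laws at time t / 2.  One of x1, x2 lies at distance at least
    r = d(x1,x2) / 2 from any given vertex, so by the Cauchy-Schwarz inequality
    it suffices to bound the energy
      J(r,s) = nu_x \sum_(d(x,z) >= r) u_s(z)^2 / nu_z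
    of the law beyond radius r ([expansion_gaussian_bound]).

    The tool for J is the integral maximum principle [energy_antitone]: if a is
    1-Lipschitz with values in [0, M], then
      \sum_z u_s(z)^2 / nu_z exp (- a(z)^2 / (4 (T + M/2 - s)))
    does not increase for s <= T.  On a manifold the shift M/2 is not there; here
    it bounds the slope of the exponent by 1, hence also its variation across an
    edge, and then the discrete gradient obeys the same inequality as the
    continuous one.  Two choices of a give
      J(r,s) <= J(r',s') + exp (- (r-r')^2 / (4 (s-s') + 2 (r-r'))) J(0,s'),
      J(r,s) <= exp (- r^2 / (4 s + 2 r)).
    The first is iterated along times t / G^k and radii decreasing to r/2, where
    G = gamma ^ n lies between 2 and 2 gamma; since J(0,s) <= 1 / f(2 s), each
    step costs at most one factor f (t / G^k) / f (t / G^(k+1)), and regularity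
    bounds all of these factors by a multiple of the first one.  The iteration
    stops at the scale m = max (T1, r), where the second estimate is stronger
    than the growth allowed to f ([tail_core], [tail_decay]).  When
    r^2 / t is small compared with the logarithm of the first factor, J(0,t/2)
    is already small enough, because 1 / f(t) is then much smaller than
    1 / f(t / G); this is why the bound is stated with f at time t / (2 gamma). *)

(** * Calculus of real functions of time *)

Section calculus.
Context {R : realType}.
Implicit Types f g : R -> R.

Lemma is_derive_add f g (x a b : R) : is_derive x 1 f a -> is_derive x 1 g b ->
  is_derive x 1 (fun y => f y + g y) (a + b).
Proof. by move=> fa gb; exact: is_deriveD. Qed.

Lemma is_derive_mul f g (x a b : R) : is_derive x 1 f a -> is_derive x 1 g b ->
  is_derive x 1 (fun y => f y * g y) (a * g x + f x * b).
Proof.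
move=> fa gb; apply: (is_derive_eq (is_deriveM fa gb)).
by rewrite addrC [_ *: _ in LHS]mulrC.
Qed.

Lemma is_derive_bigsum (I : Type) (s : seq I) (F : I -> R -> R) (dF : I -> R) (x : R) :
  (forall i, is_derive x 1 (F i) (dF i)) ->
  is_derive x 1 (fun y => \sum_(i <- s) F i y) (\sum_(i <- s) dF i).
Proof.
move=> Fd; elim: s => [|i s IH].
  rewrite big_nil (_ : (fun _ => _) = cst 0); first exact: is_derive_cst.
  by apply/funext => y; rewrite big_nil.
rewrite big_cons (_ : (fun _ => _) = fun y => F i y + \sum_(j <- s) F j y).
  exact: is_derive_add.
by apply/funext => y; rewrite big_cons.
Qed.

Lemma is_derive_reflect f (T x a : R) : is_derive (T - x) 1 f a ->
  is_derive x 1 (fun y => f (T - y)) (- a).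
Proof.
move=> fa; have h : is_derive x 1 (fun y : R => T - y) (- 1).
  by apply: (is_derive_eq (is_deriveB (is_derive_cst T x 1) (is_derive_id x 1))); rewrite sub0r.
have := @is_derive1_comp R f (fun y : R => T - y) x a (- 1) fa h.
by rewrite ?scaleN1r ?mulN1r ?mulrN1.
Qed.

Lemma is_derive_continuous f (x a : R) : is_derive x 1 f a -> {for x, continuous f}.
Proof. by move=> [fd _]; apply/differentiable_continuous/derivable1_diffP. Qed.

Lemma continuous_bigsum (I : Type) (s : seq I) (F : I -> R -> R) (x : R) :
  (forall i, {for x, continuous (F i)}) ->
  {for x, continuous (fun y => \sum_(i <- s) F i y)}.
Proof.
move=> Fc; elim: s => [|i s IH].
  rewrite (_ : (fun _ => _) = cst 0); first exact: cst_continuous.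
  by apply/funext => y; rewrite big_nil.
rewrite (_ : (fun _ => _) = fun y => F i y + \sum_(j <- s) F j y).
  by apply: continuousD => //; exact: Fc.
by apply/funext => y; rewrite big_cons.
Qed.

Lemma derive_le0_antitone f (df : R -> R) (a b : R) : a <= b ->
  (forall x, a < x -> x < b -> is_derive x 1 f (df x)) ->
  (forall x, a <= x -> x <= b -> {for x, continuous f}) ->
  (forall x, a < x -> x < b -> df x <= 0) -> f b <= f a.
Proof.
rewrite le_eqVlt => /orP[/eqP-> //|ab] fd fc df0.
have fd' x : x \in `]a, b[%R -> is_derive x 1 f (df x).
  by rewrite in_itv/= => /andP[? ?]; exact: fd.
have fc' : {within `[a, b], continuous f}.
  apply: continuous_in_subspaceT => x; rewrite inE/= in_itv/= => /andP[? ?].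
  exact: fc.
have [c] := MVT ab fd' fc'.
rewrite in_itv/= => /andP[ac cb] e.
by rewrite -subr_le0 e mulr_le0_ge0 ?df0// subr_ge0 ltW.
Qed.

Lemma derive_eq0_constant f (a b : R) : a <= b ->
  (forall x, a < x -> x < b -> is_derive x 1 f 0) ->
  (forall x, a <= x -> x <= b -> {for x, continuous f}) -> f a = f b.
Proof.
rewrite le_eqVlt => /orP[/eqP-> //|ab] fd fc.
have fd' x : x \in `]a, b[%R -> is_derive x 1 f ((cst 0) x).
  by rewrite in_itv/= => /andP[? ?]; exact: fd.
have fc' : {within `[a, b], continuous f}.
  apply: continuous_in_subspaceT => x; rewrite inE/= in_itv/= => /andP[? ?].
  exact: fc.
have [c] := MVT ab fd' fc'.
by move=> _ /eqP; rewrite mul0r subr_eq0 => /eqP.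
Qed.

(** The weight exp (- a^2 / (4 (K - s))) solves e' = - (a^2 / (4 (K - s)^2)) e,
    the equality case of the Hamilton-Jacobi inequality behind the integral
    maximum principle. *)
Lemma is_derive_weight (K a s : R) : s < K ->
  is_derive s 1 (fun r => expR (- ((4 * (K - r))^-1 * a ^+ 2)))
    (expR (- ((4 * (K - s))^-1 * a ^+ 2)) *
     (- (4 * (4 * (K - s))^-1 ^+ 2 * a ^+ 2))).
Proof.
move=> sK; have K0 : 4 * (K - s) != 0.
  by rewrite gt_eqF// mulr_gt0// subr_gt0.
have h1 : is_derive s 1 (fun r => 4 * (K - r)) (- 4).
  apply: (is_derive_eq (is_derive_mul (is_derive_cst (4 : R) s 1)
    (is_derive_reflect (T := K) (is_derive_id (K - s) 1)))).
  by rewrite mul0r add0r mulrN1.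
have h2 := @is_deriveV R (fun r => 4 * (K - r)) s (- 4) 1 K0 h1.
have h3 := is_derive_mul h2 (is_derive_cst (- (a ^+ 2)) s 1).
have h4 := is_derive1_comp (is_derive_expR _) h3.
have -> : (fun r => expR (- ((4 * (K - r))^-1 * a ^+ 2))) =
    expR \o (fun y : R => (4 * (K - y))^-1 * cst (- a ^+ 2) y).
  by apply/funext => r /=; rewrite mulrN.
apply: (is_derive_eq h4); rewrite /= mulrN mulr0 addr0; congr (_ * _).
by rewrite /GRing.scale/= exprVn; ring.
Qed.

End calculus.

Lemma lip_max (R : realType) (c x y : R) :
  `|Num.max x c - Num.max y c| <= `|x - y|.
Proof.
have h1 := ler_norm (x - y); have h2 := ler_norm (y - x); rewrite distrC in h2.
by rewrite ler_norml; case: (leP x c) => ?; case: (leP y c) => ?; apply/andP; split; lra.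
Qed.

Lemma lip_min (R : realType) (c x y : R) :
  `|Num.min x c - Num.min y c| <= `|x - y|.
Proof.
have h1 := ler_norm (x - y); have h2 := ler_norm (y - x); rewrite distrC in h2.
by rewrite ler_norml; case: (leP x c) => ?; case: (leP y c) => ?; apply/andP; split; lra.
Qed.

Section clock_derivative.
Context {R : realType}.

Lemma expR_compl_bounds (x : R) : 0 <= x ->
  x - x ^+ 2 <= 1 - expR (- x) /\ 1 - expR (- x) <= x.
Proof.
move=> x0; have e0 := expR_gt0 (- x); split; last first.
  by have := expR_ge1Dx (- x); lra.
have h : expR (- x) * (1 + x) <= 1.
  by rewrite -[leRHS](expRxMexpNx_1 x) mulrC ler_wpM2r ?expR_ge1Dx// ltW.
have h2 : expR (- x) * (1 + x) <= (1 - x + x ^+ 2) * (1 + x).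
  apply: (le_trans h); rewrite -subr_ge0.
  by rewrite (_ : _ - 1 = x ^+ 3) ?exprn_ge0//; ring.
by rewrite ler_pM2r in h2; lra.
Qed.

Lemma lipschitz_continuous_at (f : R -> R) (K t : R) : 0 <= K ->
  (forall s, `|f s - f t| <= K * `|s - t|) -> {for t, continuous f}.
Proof.
move=> K0 fK; have K1 : 0 < K + 1 by lra.
apply/cvgrPdist_lt => e e0; near=> s.
rewrite distrC; apply: (le_lt_trans (fK s)).
apply: (@le_lt_trans _ _ ((K + 1) * `|s - t|)).
  by rewrite ler_wpM2r// lerDl.
rewrite mulrC -ltr_pdivlMr// distrC.
near: s; have ct : (x @[x --> t]) --> t by exact: cvg_id.
by move/cvgrPdist_lt : ct; apply; exact: divr_gt0.
Unshelve. all: by end_near. Qed.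

(** The two difference quotients of f are squeezed between functions that are
    continuous at 0 and take the value q g(t) there.  In the application f, F, g
    are the probabilities of having left a vertex, of having reached it, and of
    standing on it. *)
Lemma clock_derivative (q t : R) (f g F : R -> R) : 0 < q -> 0 < t ->
  (forall s h, 0 <= s -> 0 <= h -> (1 - expR (- (q * h))) * g s <= f (s + h) - f s) ->
  (forall s h, 0 <= s -> 0 <= h ->
    f (s + h) - f s <= (1 - expR (- (q * h))) * (F (s + h) - F s + g s)) ->
  (forall s, 0 <= g s) ->
  (forall s h, 0 <= s -> 0 <= h -> F s <= F (s + h)) ->
  {for t, continuous g} -> {for t, continuous F} ->
  is_derive t 1 f (q * g t).
Proof.
move=> q0 t0 flo fup g0 Fnd gc Fc.
pose dg h := `|g (h + t) - g t|; pose dF h := `|F (h + t) - F t|.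
pose L h := (q - q ^+ 2 * `|h|) * (g t - dg h).
pose U h := q * (g t + dg h + dF h).
have shiftc (k : R -> R) : {for t, continuous k} ->
    {for 0, continuous (fun h : R => k (h + t))}.
  move=> kc; apply: (@continuous_comp _ _ _ (fun h : R => h + t) k).
    by apply: continuousD; [exact: cvg_id|exact: cst_continuous].
  by rewrite add0r.
have normc (k : R -> R) : {for 0, continuous k} -> {for 0, continuous (fun h => `|k h|)}.
  by move=> kc; apply: (@continuous_comp _ _ _ k (fun y : R => `|y|)) => //; exact: norm_continuous.
have dgc : {for 0, continuous dg}.
  by apply: normc; apply: continuousB; [exact: shiftc|exact: cst_continuous].
have dFc : {for 0, continuous dF}.
  by apply: normc; apply: continuousB; [exact: shiftc|exact: cst_continuous].
have Lc : {for 0, continuous L}.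
  apply: continuousM.
    apply: continuousB; first exact: cst_continuous.
    by apply: continuousM; [exact: cst_continuous|exact: norm_continuous].
  by apply: continuousB; [exact: cst_continuous|exact: dgc].
have Uc : {for 0, continuous U}.
  apply: continuousM; first exact: cst_continuous.
  by apply: continuousD => //; apply: continuousD => //; exact: cst_continuous.
have L0 : L 0 = q * g t by rewrite /L /dg add0r subrr !normr0; ring.
have U0 : U 0 = q * g t by rewrite /U /dg /dF add0r !subrr !normr0; ring.
have cv : (fun h : R => h^-1 *: ((f \o shift t) (h *: 1) - f t)) @ 0^' --> q * g t.
  have LU : \forall h \near (0 : R)^', L h <= h^-1 *: ((f \o shift t) (h *: 1) - f t) <= U h.
    near=> h.
    have h0 : h != 0 by near: h; exact: nbhs_dnbhs_neq.
    have ht : `|h| < t.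
      near: h; apply: dnbhs0_lt; exact: t0.
    have hq : `|h| < q^-1.
      by near: h; apply: dnbhs0_lt; rewrite invr_gt0.
    have Q1 : q - q ^+ 2 * `|h| = q * (1 - q * `|h|) by ring.
    have q1 : q * `|h| <= 1 by rewrite mulrC -ler_pdivlMr// mul1r ltW.
    have Q0 : 0 <= q - q ^+ 2 * `|h| by rewrite Q1 mulr_ge0 ?subr_ge0// ltW.
    have dg0 : 0 <= dg h by exact: normr_ge0.
    have dF0 : 0 <= dF h by exact: normr_ge0.
    rewrite /= scaler1.
    have bound s k : 0 < k -> k = `|h| -> 0 <= s -> g t - dg h <= g s -> g s <= g t + dg h ->
        F (s + k) - F s <= dF h ->
        L h <= k^-1 * (f (s + k) - f s) <= U h.
      move=> k0 kh s0 gl gu Fu.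
      have [e1 e2] := @expR_compl_bounds (q * k) (mulr_ge0 (ltW q0) (ltW k0)).
      have lo := flo s k s0 (ltW k0); have up := fup s k s0 (ltW k0).
      rewrite [k^-1 * _]mulrC ler_pdivlMr// ler_pdivrMr//; apply/andP; split.
        apply: le_trans lo.
        apply: (@le_trans _ _ ((q * k - (q * k) ^+ 2) * g s)); last first.
          by rewrite ler_wpM2r.
        rewrite /L -kh.
        rewrite (_ : (q * k - (q * k) ^+ 2) * g s = (q - q ^+ 2 * k) * g s * k); last by ring.
        by rewrite ler_pM2r// ler_wpM2l// kh.
      apply: (le_trans up).
      have FF : 0 <= F (s + k) - F s + g s by rewrite addr_ge0// subr_ge0 Fnd// ltW.
      apply: (@le_trans _ _ (q * k * (F (s + k) - F s + g s))); first by rewrite ler_wpM2r.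
      rewrite /U (_ : q * (g t + dg h + dF h) * k = q * k * (g t + dg h + dF h)); last by ring.
      by rewrite ler_pM2l ?mulr_gt0//; lra.
    have dgE : - dg h <= g (h + t) - g t <= dg h by rewrite -ler_norml.
    have dFE : - dF h <= F (h + t) - F t <= dF h by rewrite -ler_norml.
    move: dgE dFE => /andP[dg1 dg2] /andP[dF1 dF2].
    have [hp|hn] := ltP 0 h.
      have := bound t h hp; rewrite gtr0_norm// [t + h]addrC; apply => //; lra.
    have hn' : h < 0 by rewrite lt_neqAle h0.
    have nh : `|h| = - h by rewrite ltr0_norm.
    have := bound (h + t) (- h); rewrite nh oppr_gt0 (_ : h + t - h = t); last by ring.
    rewrite (_ : (- h)^-1 * (f t - f (h + t)) = h^-1 * (f (h + t) - f t)); last first.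
      by rewrite invrN; ring.
    by apply => //; rewrite ?nh in ht; lra.
  have Lcv : L h @[h --> (0 : R)^'] --> q * g t.
    by rewrite -L0; apply: cvg_within_filter; exact: Lc.
  have Ucv : U h @[h --> (0 : R)^'] --> q * g t.
    by rewrite -U0; apply: cvg_within_filter; exact: Uc.
  exact: (squeeze_cvgr LU Lcv Ucv).
split; first exact: cvgP cv.
exact: cvg_lim cv.
Unshelve. all: by end_near. Qed.

End clock_derivative.

(** * Iteration of the tail estimate over shrinking times and radii *)

Lemma sum_expR_decay (R : realType) (u : R) n : 0 < u ->
  \sum_(k < n) expR (- (k%:R * u)) <= 1 + u^-1.
Proof.
move=> u0; pose a : R := expR (- u).
have a0 : 0 < a by exact: expR_gt0.
have a1 : a * (1 + u) <= 1.
  by rewrite -[leRHS](expRxMexpNx_1 u) mulrC ler_wpM2r ?expR_ge1Dx// ltW.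
have -> : \sum_(k < n) expR (- (k%:R * u)) = \sum_(k < n) a ^+ k.
  by apply: eq_bigr => k _; rewrite -mulrN expRM_natl.
have an : 0 <= a ^+ n by rewrite exprn_ge0 ?ltW.
have := subrX1 a n; move: an; move: (a ^+ n) (\sum_(_ < _) _) => b S b0 e.
have h : (1 - a) * S <= 1 by rewrite -opprB mulNr -e; lra.
have h1 : a * u <= 1 - a by lra.
have h2 : u <= (1 - a) * (1 + u) by lra.
have a10 : 0 < 1 - a by apply: lt_le_trans h1; exact: mulr_gt0.
rewrite (_ : 1 + u^-1 = (1 + u) / u); last by field; rewrite lt0r_neq0.
rewrite ler_pdivlMr// -(ler_pM2l a10) mulrA (le_trans _ h2)//.
by rewrite ger_pMl.
Qed.
(** In this section J r s abstracts the energy at time s beyond radius r, and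
    lam is one bound for the growth of f over all scale changes by the factor G
    between m and t. *)
Section tail_iteration.
Context {R : realType} (J : R -> R -> R) (f : R -> R).
Hypothesis f_gt0 : forall s, 0 < s -> 0 < f s.
Hypothesis f_ndecr : forall s t, 0 <= s -> s <= t -> f s <= f t.
Hypothesis J_step : forall r r' s s', 0 <= r' -> r' < r -> 0 < s' -> s' < s ->
  J r s <= J r' s' +
    expR (- ((r - r') ^+ 2 / (4 * (s - s') + 2 * (r - r')))) * J 0 s'.
Hypothesis J_diag : forall s, 0 < s -> J 0 s <= (f (2 * s))^-1.
Hypothesis J_univ : forall r s, 0 < r -> 0 < s ->
  J r s <= expR (- (r ^+ 2 / (4 * s + 2 * r))).

Context (r t m G lam : R).
Hypotheses (r_gt0 : 0 < r) (rm : r <= m) (mt : m <= t).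
Hypotheses (G_ge2 : 2 <= G) (lam_ge1 : 1 <= lam).
Hypothesis f_double : forall s, m <= s -> s <= t / G -> f (G * s) <= lam * f s.

Let tk k : R := Num.max (t / G ^+ k) m.
Let rk k : R := r / 2 * (1 + (4 / 5) ^+ k).
Let gain k : R := (rk k - rk k.+1) ^+ 2 /
  (4 * (tk k / 2 - tk k.+1 / 2) + 2 * (rk k - rk k.+1)).

Let m_gt0 : 0 < m. Proof. exact: lt_le_trans rm. Qed.
Let t_gt0 : 0 < t. Proof. exact: lt_le_trans mt. Qed.
Let G_gt0 : 0 < G. Proof. exact: lt_le_trans G_ge2. Qed.
Let Gk_gt0 k : 0 < G ^+ k. Proof. exact: exprn_gt0. Qed.
Let tk_gt0 k : 0 < tk k.
Proof. by rewrite /tk lt_max m_gt0 orbT. Qed.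

Let rk_drop k : rk k - rk k.+1 = r / 10 * (4 / 5) ^+ k.
Proof. by rewrite /rk exprS; field. Qed.

Let rk_ge k : r / 2 <= rk k.
Proof.
have q0 : 0 <= (4 / 5 : R) ^+ k by rewrite exprn_ge0//; lra.
by rewrite /rk; move: q0 r_gt0; move: (_ ^+ k) => q ? ?; nra.
Qed.

Let rk_le k : rk k <= r.
Proof.
have q1 : (4 / 5 : R) ^+ k <= 1 by rewrite exprn_ile1//; lra.
by rewrite /rk; move: q1 r_gt0; move: (_ ^+ k) => q ? ?; nra.
Qed.

Let tdivGS k : t / G ^+ k.+1 = t / G ^+ k / G.
Proof. by rewrite exprS invfM mulrA mulrAC. Qed.

Let tkS_lt k : m < t / G ^+ k -> tk k.+1 < tk k.
Proof.
move=> mk; rewrite /tk (max_l (ltW mk)) gt_max mk andbT tdivGS.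
have p : 0 < t / G ^+ k by exact: divr_gt0.
by rewrite ltr_pdivrMr// ltr_pMr//; move: G_ge2 => ?; lra.
Qed.

(** The radii r/2 (1 + (4/5)^k) stay above r/2, and the times t / G^k are stopped
    at m; each application of the recursive estimate leaves a gaussian factor
    times the diagonal value at the next time. *)
Lemma tail_telescope n : (forall k, (k < n)%N -> m < t / G ^+ k) ->
  J r (t / 2) <=
  \sum_(k < n) expR (- gain k) / f (tk k.+1) + J (rk n) (tk n / 2).
Proof.
elim: n => [_|n IH mk].
  rewrite big_ord0 add0r /rk /tk !expr0 divr1 (max_l mt).
  by rewrite (_ : r / 2 * (1 + 1) = r)//; field.
apply: (le_trans (IH _)); first by move=> k kn; apply: mk; exact: ltnW.
rewrite big_ord_recr/= -addrA lerD2l.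
have h : J (rk n) (tk n / 2) <= J (rk n.+1) (tk n.+1 / 2) +
    expR (- gain n) * J 0 (tk n.+1 / 2).
  apply: J_step.
  - by apply: le_trans (rk_ge _); rewrite divr_ge0// ltW.
  - by rewrite -subr_gt0 rk_drop !mulr_gt0// exprn_gt0//; lra.
  - by rewrite divr_gt0.
  - by rewrite ltr_pM2r// tkS_lt// mk.
apply: (le_trans h); rewrite [leLHS]addrC lerD2r ler_wpM2l ?expR_ge0//.
have := @J_diag (tk n.+1 / 2) _; rewrite divr_gt0// => /(_ isT).
by rewrite (_ : 2 * (tk n.+1 / 2) = tk n.+1)//; field.
Qed.

(** Only scale changes that start at or above m occur, so each of them costs at
    most lam. *)
Lemma doubling_iter k : (forall j, (j <= k)%N -> m < t / G ^+ j) ->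
  f (t / G) <= lam ^+ k * f (tk k.+1).
Proof.
elim: k => [_|k IH mk].
  rewrite mul1r; apply: f_ndecr; first by rewrite divr_ge0 ?ltW.
  by rewrite /tk expr1 le_max lexx.
apply: (le_trans (IH _)); first by move=> j jk; apply: mk; exact: leqW.
have lam_gt0 : 0 < lam by apply: lt_le_trans lam_ge1.
rewrite exprSr -mulrA ler_pM2l ?exprn_gt0//.
have mkS := mk _ (leqnn _).
have h : tk k.+1 <= G * tk k.+2.
  rewrite /tk (max_l (ltW mkS)) (tdivGS k.+1) [leRHS]mulrC -ler_pdivrMr//.
  by rewrite le_max lexx.
apply: (le_trans (f_ndecr (ltW (tk_gt0 _)) h)).
apply: f_double; first by rewrite /tk le_max lexx orbT.
have e : t / G ^+ k.+1 <= t / G.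
  rewrite ler_pM2l// lef_pV2 ?posrE// exprS ler_pMr//.
  by rewrite exprn_ege1//; move: G_ge2 => ?; lra.
rewrite /tk ge_max; apply/andP; split.
  apply: le_trans e; rewrite tdivGS ler_pdivrMr// ler_pMr ?divr_gt0//.
  by move: G_ge2 => ?; lra.
by apply: le_trans e; exact: ltW.
Qed.

(** The steps of the radii shrink by 4/5 while times shrink by at least 2: the squared step over
    the time gained grows at least like (32/25)^k, which dominates a linear
    function of k. *)
Lemma gain_ge k : m < t / G ^+ k -> r ^+ 2 / t * k.+1%:R / 800 <= gain k.
Proof.
move: r_gt0 rm G_ge2 t_gt0 => r0 rm' G2 t0.
move=> mk; rewrite /gain rk_drop.
set q := (4 / 5 : R) ^+ k; set p := t / G ^+ k.
have q0 : 0 < q by rewrite exprn_gt0//; lra.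
have q1 : q <= 1 by rewrite exprn_ile1//; lra.
have p0 : 0 < p by exact: divr_gt0.
have tkk : tk k = p by rewrite /tk max_l// ltW.
have tk1 := tk_gt0 k.+1.
have tk2 := tkS_lt mk.
have rq : r * q <= p.
  by apply: le_trans (ltW mk); apply: le_trans rm; rewrite ger_pMr.
have rq0 : 0 < r * q by exact: mulr_gt0.
set D := 4 * _ + _.
have D0 : 0 < D by rewrite /D tkk; rewrite tkk in tk2; nra.
have Dp : D <= 11 / 5 * p by rewrite /D tkk; nra.
apply: (@le_trans _ _ ((r / 10 * q) ^+ 2 / (11 / 5 * p))); last first.
  by rewrite ler_wpM2l ?sqr_ge0// lef_pV2 ?posrE//; nra.
have -> : (r / 10 * q) ^+ 2 / (11 / 5 * p) = r ^+ 2 / t * (q ^+ 2 * G ^+ k) / 220.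
  rewrite /p; field.
  by rewrite ?lt0r_neq0//=.
(* Bernoulli: (32/25)^k >= 1 + 7k/25, and 220 * 25/7 < 800. *)
have bern : k.+1%:R * (7 / 25) <= q ^+ 2 * G ^+ k.
  rewrite /q -exprM mulnC exprM -exprMn.
  have h : 1 + 7 / 25 <= (4 / 5 : R) ^+ 2 * G by rewrite expr2; lra.
  have : (1 + 7 / 25 : R) ^+ k <= ((4 / 5) ^+ 2 * G) ^+ k.
    by rewrite lerXn2r ?nnegrE//; lra.
  apply: le_trans.
  apply: (@le_trans _ _ (1 + k%:R * (7 / 25))); first by rewrite -natr1; lra.
  elim: (k) => [|j IHj]; first by rewrite expr0; lra.
  rewrite exprS -natr1; have : 0 <= j%:R :> R by [].
  by move: IHj; move: (_ ^+ j) (j%:R) => x y; nra.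
have E0 : 0 < r ^+ 2 / t by rewrite divr_gt0 ?exprn_gt0.
have k0 : 0 <= k.+1%:R :> R by [].
move: bern E0 k0; move: (q ^+ 2 * G ^+ k) (r ^+ 2 / t) (k.+1%:R) => w E K.
by move=> ? ? ?; nra.
Qed.

Lemma level_exists : exists n, t / G ^+ n <= m.
Proof.
exists (Num.bound (t / m)); rewrite ler_pdivrMr// mulrC -ler_pdivrMr//.
apply: (@le_trans _ _ (Num.bound (t / m))%:R).
  by apply/ltW/archi_boundP; rewrite divr_ge0 ?ltW.
move: (Num.bound _) => n; apply: (@le_trans _ _ (2 ^+ n)).
  by rewrite -natrX ler_nat ltnW// ltn_expl.
by rewrite lerXn2r ?nnegrE//; move: G_ge2 => ?; lra.
Qed.

(** The linear gain in k absorbs the factors lam ^ k, because ln lam is at most a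
    small multiple of r^2 / t; the series over k is then geometric.  At the last
    scale the universal estimate at time m/2 and radius at least r/2 takes over,
    and W measures the growth of f up to m. *)
Lemma tail_core u W : 0 < u -> u <= 1600^-1 ->
  f m <= expR W -> 1 <= r ^+ 2 / t -> ln lam <= r ^+ 2 / t * u ->
  J r (t / 2) * f (t / G) <=
    (1 + u^-1) * expR (- (r ^+ 2 / t * u)) + expR (W - r ^+ 2 / (17 * m)).
Proof.
move=> u0 u1 fW E1 lamE; set E := r ^+ 2 / t.
case: (ex_minnP level_exists) => n tn nmin.
have mk k : (k < n)%N -> m < t / G ^+ k.
  by move=> kn; rewrite ltNge; apply/negP => /nmin; rewrite leqNgt kn.
have lam_gt0 : 0 < lam by exact: lt_le_trans lam_ge1.
have lamX k : lam ^+ k = expR (k%:R * ln lam) by rewrite expRM_natl lnK.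
have tG0 : 0 < t / G by exact: divr_gt0.
have tkn : tk n = m by rewrite /tk max_r.
have ln0 : 0 <= ln lam by exact: ln_ge0.
(* The number n of scales is minimal, so n <= 2^(n-1) <= G^(n-1) < t / m. *)
have nE : n%:R <= t / m.
  case: (n) mk => [|j] mk; first by rewrite divr_ge0 ?ltW.
  have mj := mk j (ltnSn _).
  rewrite ler_pdivlMr// mulrC -ler_pdivlMr ?ltr0n//.
  apply: (le_trans (ltW mj)); rewrite ler_pM2l// lef_pV2 ?posrE//.
  apply: (@le_trans _ _ (2 ^+ j)); first by rewrite -natrX ler_nat ltn_expl.
  by rewrite lerXn2r ?nnegrE//; move: G_ge2 => ?; lra.
have fn : f (t / G) <= lam ^+ n * f m.
  case: (n) mk tkn => [_ tk0|j mk tkj].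
    rewrite mul1r -tk0; apply: f_ndecr; first exact: ltW.
    rewrite /tk expr0 divr1 le_max ler_pdivrMr// ler_pMr//.
    by apply/orP; left; move: G_ge2 => ?; lra.
  apply: (le_trans (@doubling_iter j _)); first by move=> i ij; exact: mk.
  by rewrite tkj exprSr -mulrA ler_pM2l ?exprn_gt0// ler_pMl// f_gt0.
have tele := tail_telescope mk.
rewrite -ler_pdivlMr ?f_gt0//; apply: (le_trans tele).
rewrite mulrDl; apply: lerD.
  apply: (@le_trans _ _ (\sum_(k < n) expR (- (k%:R * u)) *
                         (expR (- (E * u)) / f (t / G)))); last first.
    rewrite -mulr_suml -[leRHS]mulrA ler_wpM2r ?sum_expR_decay//.
    rewrite mulr_ge0 ?expR_ge0//.
    by rewrite invr_ge0 ltW// f_gt0.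
  apply: ler_sum => k _.
  have h1 := @doubling_iter k _.
  have h2 := gain_ge (mk k (ltn_ord k)).
  have {}h1 : f (t / G) <= lam ^+ k * f (tk k.+1).
    by apply: h1 => j jk; apply: mk; apply: leq_ltn_trans jk _.
  rewrite mulrA ler_pdivlMr ?f_gt0// mulrAC ler_pdivrMr ?f_gt0//.
  apply: (@le_trans _ _ (expR (- gain k) * (lam ^+ k * f (tk k.+1)))).
    by rewrite ler_wpM2l ?expR_ge0.
  rewrite mulrA; apply: ler_wpM2r; first by rewrite ltW// f_gt0.
  (* The terms k ln lam, k u and E u together cost at most 2 (k+1) E u, which the
     gain (k+1) E / 800 pays for when u <= 1/1600. *)
  rewrite lamX -!expRD ler_expR.
  have k0 : 0 <= k%:R :> R by [].
  have : k%:R * ln lam <= k%:R * (E * u) by rewrite ler_wpM2l.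
  have kE : k%:R <= k%:R * E by rewrite ler_peMr.
  move: h2; rewrite -natr1 -/E; move: kE E1 k0; rewrite -/E.
  move: (k%:R) E (gain k) (ln lam) => K e g l h2 h3 h4 h5 h6.
  have : (K * e + e) * u <= (K * e + e) * 1600^-1 by rewrite ler_wpM2l//; lra.
  have : K * u <= K * e * u by rewrite ler_wpM2r// ltW.
  have : 0 <= e * u by rewrite mulr_ge0//; lra.
  lra.
apply: (le_trans (J_univ _ _)).
- by apply: lt_le_trans (rk_ge n); rewrite divr_gt0.
- by rewrite divr_gt0.
rewrite tkn ler_pdivlMr ?f_gt0//.
apply: (@le_trans _ _ (expR (- (r ^+ 2 / (16 * m))) *
                       (expR (n%:R * ln lam) * expR W))).
  apply: ler_pM; first exact: expR_ge0.
  - by rewrite ltW// f_gt0.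
  - rewrite ler_expR lerN2.
    have h0 := rk_ge n; have h1 := rk_le n.
    have rr : r ^+ 2 / 4 <= rk n ^+ 2.
      by move: r_gt0 h0; rewrite !expr2; move: (rk n) => x *; nra.
    have dd : 4 * (m / 2) + 2 * rk n <= 4 * m by move: rm h1 => *; lra.
    have d0 : 0 < 4 * (m / 2) + 2 * rk n by move: r_gt0 m_gt0 h0 => *; lra.
    rewrite (_ : r ^+ 2 / (16 * m) = r ^+ 2 / 4 / (4 * m)); last first.
      by field; rewrite lt0r_neq0.
    apply: ler_pM => //; first by rewrite divr_ge0 ?sqr_ge0.
      by rewrite invr_ge0 mulr_ge0// ltW.
    by rewrite lef_pV2 ?posrE// mulr_gt0.
  by apply: (le_trans fn); rewrite lamX ler_wpM2l ?expR_ge0.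
rewrite -!expRD ler_expR.
(* n ln lam <= u r^2 / m turns the denominator 16 m into 17 m. *)
have : n%:R * ln lam <= t / m * (E * u).
  by apply: ler_pM.
have -> : t / m * (E * u) = r ^+ 2 / m * u.
  by rewrite /E; field; rewrite !lt0r_neq0.
have -> : r ^+ 2 / (16 * m) = r ^+ 2 / m / 16 by field; rewrite lt0r_neq0.
have -> : r ^+ 2 / (17 * m) = r ^+ 2 / m / 17 by field; rewrite lt0r_neq0.
have x0 : 0 <= r ^+ 2 / m by rewrite divr_ge0 ?sqr_ge0 ?ltW.
have := ler_wpM2l x0 u1; move: x0.
by move: (r ^+ 2 / m) (n%:R * _) => x y *; lra.
Qed.

End tail_iteration.

(** The exponent epsilon < 1 makes the admitted growth of f negligible against
    the linear exponent that the universal tail estimate gives at time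
    comparable to the radius. *)
Lemma sublinear_powR (R : realType) (delta epsilon : R) :
  0 <= delta -> 0 <= epsilon -> epsilon < 1 ->
  exists2 K : R, 0 <= K & forall s, 0 < s -> delta * s `^ epsilon <= s / 100 + K.
Proof.
move=> d0 e0 e1; pose b := 100 * delta + 1; pose s0 := b `^ (1 - epsilon)^-1.
have b0 : 0 < b by rewrite /b; lra.
have e10 : 0 < 1 - epsilon by rewrite subr_gt0.
have s00 : 0 < s0 by exact: powR_gt0.
have s0e : s0 `^ (1 - epsilon) = b.
  by rewrite /s0 -powRrM mulVf ?powRr1 ?lt0r_neq0// ltW.
exists (delta * s0 `^ epsilon) => [|s sp]; first by rewrite mulr_ge0// powR_ge0.
have [s0s|ss0] := leP s0 s.
  have h : b <= s `^ (1 - epsilon).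
    by rewrite -s0e; apply: ge0_ler_powR; rewrite ?nnegrE// ltW.
  have se : s `^ epsilon * s `^ (1 - epsilon) = s.
    rewrite -powRD; first by rewrite addrC subrK powRr1// ltW.
    by rewrite lt0r_neq0// implybT.
  have : s `^ epsilon * b <= s by rewrite -[leRHS]se ler_wpM2l// powR_ge0.
  have : 0 <= delta * s0 `^ epsilon by rewrite mulr_ge0// powR_ge0.
  have := powR_ge0 s epsilon; rewrite /b; move: (s `^ epsilon) (s0 `^ _) => x y; lra.
apply: (@le_trans _ _ (delta * s0 `^ epsilon)); last by rewrite lerDr divr_ge0// ltW.
by rewrite ler_wpM2l//; apply: ge0_ler_powR; rewrite ?nnegrE// ltW.
Qed.

(** The iteration needs scales shrinking by at least 2; the power of gamma cannot
    exceed 2 gamma, as f is evaluated in the end at t / (2 gamma). *)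
Lemma doubling_power (R : realType) (gamma : R) : 1 < gamma ->
  exists n : nat, [/\ (0 < n)%N, 2 <= gamma ^+ n & gamma ^+ n <= 2 * gamma].
Proof.
move=> g1; have ex : exists n, 2 <= gamma ^+ n.
  have g0 : 0 < gamma - 1 by rewrite subr_gt0.
  exists (Num.bound ((gamma - 1)^-1)).
  have : (gamma - 1)^-1 < (Num.bound ((gamma - 1)^-1))%:R.
    by apply: archi_boundP; rewrite invr_ge0 ltW.
  move: (Num.bound _) => n; rewrite -[_^-1]mul1r ltr_pdivrMr// => h.
  apply: (@le_trans _ _ (1 + n%:R * (gamma - 1))); first by lra.
  elim: (n) => [|k IH]; first by rewrite mul0r addr0 expr0.
  have k0 : 0 <= k%:R * (gamma - 1) by rewrite mulr_ge0// ltW.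
  rewrite exprS -natr1; move: IH k0; move: (k%:R) (gamma ^+ k) => x y IH k0.
  have : gamma * (1 + x * (gamma - 1)) <= gamma * y by rewrite ler_wpM2l//; lra.
  have : 0 <= (gamma - 1) * (x * (gamma - 1)) by rewrite mulr_ge0// ltW.
  lra.
case: (ex_minnP ex) => -[|n] n2 nmin; first by move: n2; rewrite expr0; lra.
exists n.+1; split => //; rewrite exprS mulrC ler_wpM2r//; first by lra.
by rewrite leNgt; apply/negP => /ltW /nmin; rewrite ltnn.
Qed.

(** The ratio for gamma ^ n is a product of n ratios for gamma, taken at points
    that are all at least T1 on the left and below T2 / gamma on the right. *)
Lemma regular_iter (R : realType) (A gamma T1 : R) (T2 : \bar R) (f : R -> R) n s t :
  1 <= A -> 1 < gamma -> 0 <= T1 -> regular A gamma T1 T2 f -> 0 < s ->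
  T1 <= s -> s < t -> ((gamma ^+ n * t)%:E < T2)%E ->
  f (gamma ^+ n * s) / f s <= A ^+ n * (f (gamma ^+ n * t) / f t).
Proof.
move=> A1 g1 T10 [f_ge0 f_gt0 f_nd f_ratio] s0 T1s st.
have t0 : 0 < t by apply: lt_trans st.
have g0 : 0 < gamma by lra.
have gn k : 0 < gamma ^+ k by exact: exprn_gt0.
have gn1 k : 1 <= gamma ^+ k by apply: exprn_ege1; exact: ltW.
have fg k x : 0 < x -> f (gamma ^+ k * x) != 0 by move=> x0; rewrite gt_eqF// f_gt0// mulr_gt0.
elim: n => [|n IH] tT2.
  by rewrite !expr0 !mul1r !divff ?lexx// gt_eqF// f_gt0.
have tT2' : ((gamma ^+ n * t)%:E < T2)%E.
  apply: le_lt_trans tT2; rewrite lee_fin ler_pM2r// exprS ler_pMl//.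
  exact: ltW.
have h : f (gamma * (gamma ^+ n * s)) / f (gamma ^+ n * s) <=
    A * (f (gamma * (gamma ^+ n * t)) / f (gamma ^+ n * t)).
  apply: f_ratio.
  - by apply: (le_trans T1s); rewrite ler_pMl.
  - by rewrite ltr_pM2l.
  - by rewrite lte_pdivlMl// -EFinM mulrA -exprS.
rewrite !exprS -!mulrA.
have -> : f (gamma * (gamma ^+ n * s)) / f s =
  f (gamma * (gamma ^+ n * s)) / f (gamma ^+ n * s) * (f (gamma ^+ n * s) / f s).
  by field; rewrite fg// gt_eqF// f_gt0.
have -> : A * (A ^+ n * (f (gamma * (gamma ^+ n * t)) / f t)) =
  A * (f (gamma * (gamma ^+ n * t)) / f (gamma ^+ n * t)) * (A ^+ n * (f (gamma ^+ n * t) / f t)).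
  by field; rewrite fg// gt_eqF// f_gt0.
have f0 k : 0 <= f (gamma ^+ k * s) by rewrite f_ge0// mulr_ge0// ltW.
have fS : 0 <= f (gamma * (gamma ^+ n * s)) by rewrite mulrA -exprS.
apply: ler_pM => //; last exact: IH.
  by rewrite divr_ge0.
by rewrite divr_ge0// f_ge0// ltW.
Qed.

(** A constant that serves all energies J and all f at once: the quantifiers over
    J and f stand inside, so that the constant is fixed before the graph. *)
Definition tail_constant {R : realType} (A gamma delta epsilon u C : R) : Prop :=
  forall (J : R -> R -> R) (f : R -> R) (T1 : R) (T2 : \bar R) (r t : R),
  0 <= T1 -> (T1%:E < T2)%E -> regular A gamma T1 T2 f ->
  (forall s, T1 <= s -> (s%:E < T2)%E -> f s <= A * expR (delta * s `^ epsilon)) ->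
  (forall r r' s s', 0 <= r' -> r' < r -> 0 < s' -> s' < s ->
    J r s <= J r' s' +
      expR (- ((r - r') ^+ 2 / (4 * (s - s') + 2 * (r - r')))) * J 0 s') ->
  (forall r s, 0 <= r -> J r s <= J 0 s) ->
  (forall s, 0 < s -> J 0 s <= (f (2 * s))^-1) ->
  (forall r s, 0 < r -> 0 < s ->
    J r s <= expR (- (r ^+ 2 / (4 * s + 2 * r)))) ->
  0 < r -> 2 * r <= t -> 2 ^+ 9 * delta * T1 `^ (1 + epsilon) <= t ->
  (t%:E < T2)%E ->
  J r (t / 2) <= C / f (t / (2 * gamma)) * expR (- (r ^+ 2 / t * u)).

Section tail_decay.
Context {R : realType} (A gamma delta epsilon u : R).
Hypotheses (A_ge1 : 1 <= A) (gamma_gt1 : 1 < gamma) (delta_ge0 : 0 <= delta)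
  (epsilon_ge0 : 0 <= epsilon) (epsilon_lt1 : epsilon < 1)
  (u_gt0 : 0 < u) (u_le : u <= 1600^-1).

(** If r^2 / t < 1 there is nothing to gain, and if lam exceeds
    exp (u r^2 / t) then 1 / f(t) is smaller than 1 / f(t / G) by the required
    factor, up to A^n.  Otherwise the iteration applies down to m = max (T1, r), or with
    m = t and no scales at all when t < T1; in each case the universal estimate
    at scale m absorbs the growth of f up to m, through the sublinear bound if
    m = r and through the lower bound on t otherwise. *)
Lemma tail_decay : exists2 C : R, 0 < C & tail_constant A gamma delta epsilon u C.
Proof.
have [K K0 absorb] := sublinear_powR delta_ge0 epsilon_ge0 epsilon_lt1.
have [n [n0 G2 G2g]] := doubling_power gamma_gt1.
set G := gamma ^+ n in G2 G2g.
have A0 : 0 < A by exact: lt_le_trans A_ge1.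
have B1 : 1 <= A ^+ n by exact: exprn_ege1.
have B0 : 0 < A ^+ n by exact: exprn_gt0.
have ui0 : 0 < u^-1 by rewrite invr_gt0.
pose C : R := expR 1 + A ^+ n + (1 + u^-1) + A * expR (K + 1).
have Ae0 : 0 < A * expR (K + 1) by rewrite mulr_gt0 ?expR_gt0.
have e0 := expR_gt0 (1 : R).
have C0 : 0 < C by rewrite /C; lra.
exists C => // J f T1 T2 r t T10 T12 freg fgrow Jstep Jmono Jdiag Juniv r0 rt tT1 tT2.
have [f_ge0 f_gt0 f_ndecr _] := freg.
have [A1 g1 hu] := And3 A_ge1 gamma_gt1 u_gt0.
have hu1 : u <= 100^-1 by apply: (le_trans u_le); lra.
have t0 : 0 < t by lra.
have G0 : 0 < G by lra.
have g0 : 0 < gamma by lra.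
have tG0 : 0 < t / G by exact: divr_gt0.
have tG : t / G <= t by rewrite ler_pdivrMr// ler_pMr//; lra.
set E := r ^+ 2 / t.
have E0 : 0 < E by rewrite divr_gt0 ?exprn_gt0.
suff main : J r (t / 2) * f (t / G) <= C * expR (- (E * u)).
  rewrite mulrAC ler_pdivlMr; last by rewrite f_gt0 ?divr_gt0 ?mulr_gt0.
  have [J0|J0] := leP 0 (J r (t / 2)).
    apply: le_trans main; rewrite ler_wpM2l// f_ndecr//; first by rewrite divr_ge0 ?mulr_ge0 ?ltW.
    by rewrite ler_pM2l// lef_pV2 ?posrE ?mulr_gt0.
  apply: (@le_trans _ _ 0); first by rewrite pmulr_lle0 ?ltW// f_gt0// divr_gt0 ?mulr_gt0.
  by rewrite mulr_ge0 ?expR_ge0 ?ltW.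
have Jt : J r (t / 2) <= (f t)^-1.
  apply: (le_trans (Jmono _ _ (ltW r0))).
  have := @Jdiag (t / 2); rewrite divr_gt0// => /(_ isT).
  by rewrite (_ : 2 * (t / 2) = t)//; field.
have ft0 := f_gt0 _ t0.
have ftG0 := f_gt0 _ tG0.
have ftG : f (t / G) <= f t by rewrite f_ndecr// ltW.
have Eu0 := expR_gt0 (- (E * u)).
pose lam : R := A ^+ n * (f t / f (t / G)).
have lam1 : 1 <= lam.
  by rewrite /lam -[leLHS]mulr1 ler_pM// ler_pdivlMr// mul1r.
have [E1|E1] := ltP E 1.
  apply: (@le_trans _ _ 1).
    apply: (@le_trans _ _ ((f t)^-1 * f (t / G))); first by rewrite ler_wpM2r// ltW.
    by rewrite mulrC ler_pdivrMr// mul1r.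
  apply: (@le_trans _ _ (expR 1 * expR (- (E * u)))).
    rewrite -expRD -[leLHS]expR0 ler_expR.
    have : E * u <= 1 * 1 by apply: ler_pM; lra.
    lra.
  by rewrite ler_pM2r// /C; lra.
have [lamE|lamE] := leP (ln lam) (E * u); last first.
  apply: (@le_trans _ _ (A ^+ n * expR (- (E * u)))); last first.
    by rewrite ler_pM2r// /C; lra.
  apply: (@le_trans _ _ (A ^+ n / lam)).
    apply: (@le_trans _ _ ((f t)^-1 * f (t / G))); first by rewrite ler_wpM2r// ltW.
    rewrite /lam (_ : A ^+ n / (A ^+ n * (f t / f (t / G))) = (f t)^-1 * f (t / G))//.
    by field; rewrite !lt0r_neq0.
  rewrite ler_pM2l// expRN lef_pV2 ?posrE ?expR_gt0//; last by lra.
  by rewrite -[leRHS]lnK ?ler_expR ?ltW// posrE; lra.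
have [tltT1|T1t] := ltP t T1.
- have fW : f t <= expR (ln A + 1).
    apply: (@le_trans _ _ (f T1)); first by rewrite f_ndecr ?ltW.
    apply: (le_trans (fgrow _ (lexx _) T12)).
    rewrite expRD lnK ?posrE// ler_pM2l// ler_expR.
    have T10' : 0 < T1 by apply: lt_trans tltT1.
    have : 2 ^+ 9 * delta * T1 `^ (1 + epsilon) <= 1 * T1.
      by rewrite mul1r (le_trans tT1)// ltW.
    rewrite powRD; last by rewrite lt0r_neq0// implybT.
    rewrite powRr1// mulrCA mulrC ler_pM2r//.
    have : 0 <= delta * T1 `^ epsilon by rewrite mulr_ge0 ?powR_ge0.
    by rewrite -mulrA; move: (delta * _) => x; rewrite -natrX; lra.
  have dbl s : t <= s -> s <= t / G -> f (G * s) <= lam * f s.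
    move=> ts sG; suff : t < t by rewrite ltxx.
    apply: (le_lt_trans ts); apply: (le_lt_trans sG).
    by rewrite ltr_pdivrMr// ltr_pMr//; lra.
  have rt' : r <= t by lra.
  have := tail_core f_gt0 f_ndecr Jstep Jdiag Juniv r0 rt' (lexx t) G2 lam1 dbl
     u_gt0 u_le fW E1 lamE.
  rewrite -/E => /le_trans; apply; rewrite /C !(mulrDl _ _ (expR _)).
  have : expR (ln A + 1 - r ^+ 2 / (17 * t)) <= A * expR (K + 1) * expR (- (E * u)).
    rewrite -[X in X * expR (K + 1)](lnK (x:=A)) ?posrE// -!expRD ler_expR.
    have -> : r ^+ 2 / (17 * t) = E / 17 by rewrite /E; field; rewrite lt0r_neq0.
    have : E * u <= E * 100^-1 by rewrite ler_pM2l.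
    lra.
  have : 0 < expR 1 * expR (- (E * u)) by rewrite mulr_gt0.
  have : 0 < A ^+ n * expR (- (E * u)) by rewrite mulr_gt0.
  lra.
pose m := Num.max T1 r.
have rm : r <= m by rewrite le_max lexx orbT.
have T1m : T1 <= m by rewrite le_max lexx.
have mt : m <= t by rewrite ge_max T1t; lra.
have m0 : 0 < m by exact: lt_le_trans rm.
have fW : f m <= expR (ln A + delta * m `^ epsilon).
  rewrite expRD lnK ?posrE//; apply: fgrow => //.
  by apply: le_lt_trans tT2; rewrite lee_fin.
have dbl s : m <= s -> s <= t / G -> f (G * s) <= lam * f s.
  move=> ms; rewrite le_eqVlt => /orP[/eqP->|sG].
    rewrite mulrC divfK ?lt0r_neq0// /lam -mulrA divfK ?lt0r_neq0//.
    by rewrite ler_pMl.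
  have s0 : 0 < s by exact: lt_le_trans ms.
  rewrite -ler_pdivrMr ?f_gt0//.
  have := regular_iter (n := n) A_ge1 gamma_gt1 T10 freg s0 (le_trans T1m ms) sG.
  have e : gamma ^+ n * (t / G) = t by rewrite -/G mulrC divfK ?lt0r_neq0.
  by rewrite e -/G; apply.
have := tail_core f_gt0 f_ndecr Jstep Jdiag Juniv r0 rm mt G2 lam1 dbl
     u_gt0 u_le fW E1 lamE.
rewrite -/E => /le_trans; apply; rewrite /C !(mulrDl _ _ (expR _)).
have : expR (ln A + delta * m `^ epsilon - r ^+ 2 / (17 * m)) <=
    A * expR (K + 1) * expR (- (E * u)).
  rewrite -[X in X * expR (K + 1)](lnK (x:=A)) ?posrE// -!expRD ler_expR.
  suff : delta * m `^ epsilon + E * u <= K + r ^+ 2 / (17 * m) by lra.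
  have Eu : E * u <= E * 100^-1 by rewrite ler_pM2l.
  have [T1r|rT1] := leP T1 r.
    have mr : m = r by rewrite /m max_r.
    have h := absorb _ r0.
    rewrite mr (_ : r ^+ 2 / (17 * r) = r / 17); last by field; rewrite lt0r_neq0.
    have : E <= r.
      rewrite /E ler_pdivrMr// expr2 ler_pM2l//; lra.
    lra.
  have mT : m = T1 by rewrite /m max_l// ltW.
  have T10' : 0 < T1 by rewrite -mT.
  rewrite mT.
  have tr : t <= r ^+ 2 by move: E1; rewrite /E ler_pdivlMr// mul1r.
  have h : 2 ^+ 9 * (delta * T1 `^ epsilon) <= r ^+ 2 / T1.
    rewrite ler_pdivlMr//; apply: le_trans tr; apply: le_trans tT1.
    rewrite powRD; last by rewrite lt0r_neq0// implybT.
    by rewrite powRr1// -!mulrA [T1 * _]mulrC.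
  have h1 : E <= r ^+ 2 / T1.
    by rewrite /E ler_wpM2l ?sqr_ge0// lef_pV2 ?posrE.
  rewrite (_ : r ^+ 2 / (17 * T1) = r ^+ 2 / T1 / 17); last by field; rewrite lt0r_neq0.
  move: h h1; rewrite -natrX; move: (delta * _) (r ^+ 2 / T1) => x y h h1.
  lra.
have : 0 < expR 1 * expR (- (E * u)) by rewrite mulr_gt0.
have : 0 < A ^+ n * expR (- (E * u)) by rewrite mulr_gt0.
lra.
Qed.
End tail_decay.

(** * Weighted edge inequality *)

(** The left side is 4 sinh(k)^2, asymptotic to 4 k^2; the constant 8 leaves
    room for all k <= 1/2, and an elementary bound of the exponential suffices. *)
Lemma expR_sub_expRN_le (R : realType) (k : R) : 0 <= k -> k <= 1 / 2 ->
  (expR k - expR (- k)) ^+ 2 <= 8 * k ^+ 2.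
Proof.
move=> k0 k1; pose h := k / 2; pose g := 1 - h.
have h0 : 0 <= h by rewrite /h; lra.
have h1 : h <= 1 / 4 by rewrite /h; lra.
have g0 : 0 < g by rewrite /g; lra.
have x0 := expR_gt0 h; have y0 := expR_gt0 (- h).
have yg : g <= expR (- h) by rewrite /g; apply: le_trans (expR_ge1Dx _); lra.
have xy : expR h * expR (- h) = 1 by exact: expRxMexpNx_1.
(* With h = k/2 and g = 1 - h: exp h <= 1/g and exp (-h) >= g, and
   (28/5)^2 h^2 = 7.84 k^2. *)
have xg : expR h <= g^-1.
  by rewrite -[leLHS]invrK lef_pV2 ?posrE ?invr_gt0// -expRN.
have kE : k = h + h by rewrite /h; lra.
rewrite kE opprD !expRD -!expr2.
have dle : expR h ^+ 2 - expR (- h) ^+ 2 <= 28 / 5 * h.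
  apply: (@le_trans _ _ (g^-1 ^+ 2 - g ^+ 2)).
    have gi0 : 0 <= g^-1 by rewrite invr_ge0 ltW.
    by rewrite lerB// lerXn2r ?nnegrE// ltW.
  rewrite -subr_ge0.
  have -> : 28 / 5 * h - (g^-1 ^+ 2 - g ^+ 2) =
     h * (8 / 5 - 26 / 5 * h + 8 / 5 * h ^+ 2 + h ^+ 3) / g ^+ 2.
    by rewrite /g; field; rewrite -/g lt0r_neq0.
  rewrite divr_ge0 ?sqr_ge0// mulr_ge0//.
  have : 0 <= h ^+ 2 by rewrite sqr_ge0.
  have : 0 <= h ^+ 3 by rewrite exprn_ge0.
  lra.
have dge : 0 <= expR h ^+ 2 - expR (- h) ^+ 2.
  rewrite subr_ge0 lerXn2r ?nnegrE ?expR_ge0// ler_expR; lra.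
have : (expR h ^+ 2 - expR (- h) ^+ 2) ^+ 2 <= (28 / 5 * h) ^+ 2.
  by rewrite lerXn2r ?nnegrE//; lra.
move=> /le_trans; apply; have : 0 <= h ^+ 2 by rewrite sqr_ge0.
by rewrite !expr2; lra.
Qed.

(** If b <= a, the vertex carrying a has the smaller weight P.  Maximising over
    the value y at the other vertex, whose weight is Q, leaves
    x^2 (Q - P)^2 / (4 Q); here (Q - P)^2 <= 8 k^2 P Q, where k is half the
    difference of the exponents, and k <= c a d.  The whole loss is thus charged
    to the vertex with the larger a, without any comparison of P and Q. *)
Lemma edge_dissipation (R : realType) (c d a b x y : R) :
  0 <= c -> 0 <= a -> 0 <= b -> `|a - b| <= d -> d <= 1 ->
  c * a <= 1 / 2 -> c * b <= 1 / 2 ->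
  (expR (- (c * a ^+ 2)) * x - expR (- (c * b ^+ 2)) * y) * (y - x) <=
  2 * c ^+ 2 * d ^+ 2 * (a ^+ 2 * x ^+ 2 * expR (- (c * a ^+ 2)) +
                         b ^+ 2 * y ^+ 2 * expR (- (c * b ^+ 2))).
Proof.
move=> c0; wlog ba : a b x y / b <= a => [hw|] a0 b0 abd d1 ca cb.
  have [h|ab] := leP b a; first exact: hw.
  have := hw b a y x (ltW ab) b0 a0; rewrite distrC => /(_ abd d1 cb ca).
  by move=> h; lra.
pose k := c * (a ^+ 2 - b ^+ 2) / 2.
have ab0 : 0 <= a - b by rewrite subr_ge0.
have abd' : a - b <= d by apply: le_trans abd; exact: ler_norm.
have k0 : 0 <= k by rewrite /k subr_sqr divr_ge0// !mulr_ge0// addr_ge0.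
have kc : k <= c * a * d.
  rewrite /k subr_sqr.
  have : (a - b) * (a + b) <= d * (2 * a) by apply: ler_pM => //; lra.
  by move=> /(ler_wpM2l c0); lra.
have k1 : k <= 1 / 2.
  apply: (le_trans kc); apply: (@le_trans _ _ (1 / 2 * 1)); last by lra.
  by apply: ler_pM => //; [exact: mulr_ge0|lra].
set P := expR (- (c * a ^+ 2)); set Q := expR (- (c * b ^+ 2)).
have P0 : 0 < P by exact: expR_gt0.
have Q0 : 0 < Q by exact: expR_gt0.
have QP : (Q - P) ^+ 2 <= 8 * k ^+ 2 * (P * Q).
  have PQ : P * Q = expR (- (c * (a ^+ 2 + b ^+ 2) / 2)) ^+ 2.
    by rewrite /P /Q -expRD -expRM_natl; congr expR; lra.
  have -> : Q - P = (expR k - expR (- k)) * expR (- (c * (a ^+ 2 + b ^+ 2) / 2)).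
    by rewrite mulrBl -!expRD /Q /P /k; congr (expR _ - expR _); lra.
  by rewrite exprMn PQ ler_wpM2r ?sqr_ge0// expR_sub_expRN_le.
have step1 : (P * x - Q * y) * (y - x) <= x ^+ 2 * (Q - P) ^+ 2 / (4 * Q).
  rewrite ler_pdivlMr ?mulr_gt0//.
  have : 0 <= (2 * Q * y - (P + Q) * x) ^+ 2 by rewrite sqr_ge0.
  by rewrite !expr2; lra.
apply: (le_trans step1).
apply: (@le_trans _ _ (2 * k ^+ 2 * x ^+ 2 * P)).
  rewrite ler_pdivrMr ?mulr_gt0//.
  have := ler_wpM2l (sqr_ge0 x) QP; lra.
have k2 : k ^+ 2 <= c ^+ 2 * a ^+ 2 * d ^+ 2.
  rewrite -!exprMn; rewrite lerXn2r ?nnegrE// (le_trans k0)//.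
have h1 : 0 <= c ^+ 2 * d ^+ 2 * (b ^+ 2 * y ^+ 2 * Q).
  apply: mulr_ge0; first by rewrite mulr_ge0 ?sqr_ge0.
  by apply: mulr_ge0; [rewrite mulr_ge0 ?sqr_ge0|exact: ltW].
have h2 : 0 <= x ^+ 2 * P by apply: mulr_ge0; [exact: sqr_ge0|exact: ltW].
by have := ler_wpM2l h2 k2; lra.
Qed.

(** * Jump expansion of the heat kernel *)

(** The generator does not see loops, hence their weights are discarded. *)
Definition off_diag {R : realType} {V : choiceType} (mu : V -> V -> R) (x y : V) : R :=
  if x == y then 0 else mu x y.

(** The rate at which mass that has made n - 1 jumps arrives at y with its
    n-th jump, where the mass sits in D. *)
Definition inflow {R : realType} {V : choiceType} (nu : V -> R) (mu : V -> V -> R)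
    (p : nat -> R -> V -> R) (D : seq V) (n : nat) (t : R) (y : V) : R :=
  if n is m.+1 then \sum_(z <- D) p m t z / nu z * off_diag mu z y else 0.

(** What the analysis uses of the walk: p x n t y is the probability of standing
    at y at time t after exactly n jumps from x.  Finitely many vertices are
    reached with at most N jumps, so the forward equation for n <= N is a
    finite system. *)
Record jump_expansion (R : realType) (V : choiceType) (nu : V -> R)
    (mu : V -> V -> R) (q : V -> R) (p : V -> nat -> R -> V -> R) : Prop :=
  JumpExpansion {
  expansion_ge0 : forall x n t y, 0 <= p x n t y;
  expansion_support : forall x N, exists2 D : seq V, uniq D &
    forall n t y, (n <= N)%N -> y \notin D -> p x n t y = 0;
  expansion_start : forall x n y, p x n 0 y = ((n == 0%N) && (x == y))%:R;
  expansion_continuous : forall x n y (t : R), {for t, continuous (fun s => p x n s y)};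
  expansion_derive : forall x n y (t : R) (D : seq V), 0 < t -> uniq D ->
    (forall m s z, (m < n)%N -> z \notin D -> p x m s z = 0) ->
    is_derive t 1 (fun s => p x n s y)
      (inflow nu mu (p x) D n t y - q y * p x n t y) }.

(** Reordering the pairs (k, n - k) with n < N by their first entry. *)
Lemma triangle_sum (R : realType) (c : nat -> nat -> R) N :
  \sum_(n < N) \sum_(k < n.+1) c k (n - k)%N = \sum_(k < N) \sum_(j < N - k) c k j.
Proof.
elim: N => [|N IH]; first by rewrite !big_ord0.
rewrite big_ord_recr/= IH [RHS]big_ord_recr/= subSnn big_ord1.
rewrite [X in _ + X = _]big_ord_recr/= subnn addrA; congr (_ + _).
rewrite -big_split/=; apply: eq_bigr => k _.
by rewrite subSn ?(ltnW (ltn_ord k))// big_ord_recr/=.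
Qed.

Lemma ler_sum_ord_widen (R : realType) (F : nat -> R) m n : (m <= n)%N ->
  (forall k, 0 <= F k) -> \sum_(k < m) F k <= \sum_(k < n) F k.
Proof.
move=> mn F0; rewrite -(subnKC mn) big_split_ord/= lerDl.
by apply: sumr_ge0.
Qed.

Lemma sum_cond_le (R : realType) (V : Type) (D : seq V) (P : pred V) (F : V -> R) : (forall z, 0 <= F z) ->
  \sum_(z <- D | P z) F z <= \sum_(z <- D) F z.
Proof.
by move=> F0; rewrite big_mkcond/=; apply: ler_sum => z _; case: ifP.
Qed.

(** The Cauchy-Schwarz inequality through
    2 a b <= (be / al) a^2 + (al / be) b^2, with al and be bounding the norms. *)
Lemma sum_mul_le_of_sqr (R : realType) (V : Type) (D : seq V) (P : pred V) (w a b : V -> R) (al be : R) :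
  0 < al -> 0 < be -> (forall z, 0 <= w z) ->
  \sum_(z <- D | P z) a z ^+ 2 * w z <= al ^+ 2 ->
  \sum_(z <- D | P z) b z ^+ 2 * w z <= be ^+ 2 ->
  \sum_(z <- D | P z) a z * b z * w z <= al * be.
Proof.
move=> al0 be0 w0 ha hb.
apply: (@le_trans _ _ (be / (2 * al) * \sum_(z <- D | P z) a z ^+ 2 * w z +
   al / (2 * be) * \sum_(z <- D | P z) b z ^+ 2 * w z)).
  rewrite !mulr_sumr -big_split/=; apply: ler_sum => z _.
  rewrite -subr_ge0.
  have -> : be / (2 * al) * (a z ^+ 2 * w z) + al / (2 * be) * (b z ^+ 2 * w z) -
     a z * b z * w z = (be * a z - al * b z) ^+ 2 / (2 * al * be) * w z.
    by field; rewrite !gt_eqF.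
  by rewrite mulr_ge0// divr_ge0 ?sqr_ge0// !mulr_ge0// ltW.
apply: (@le_trans _ _ (be / (2 * al) * al ^+ 2 + al / (2 * be) * be ^+ 2)).
  by apply: lerD; apply: ler_wpM2l => //; rewrite divr_ge0 ?mulr_ge0// ltW.
rewrite le_eqVlt; apply/orP; left; apply/eqP; field; by rewrite !gt_eqF.
Qed.
Section expansion_theory.
Context {R : realType} {V : choiceType} (nu : V -> R) (mu : V -> V -> R).
Context (q : V -> R) (p : V -> nat -> R -> V -> R).
Hypotheses (nu_gt0 : forall x, 0 < nu x) (mu_sym : forall x y, mu x y = mu y x).
Hypothesis jp : jump_expansion nu mu q p.

Let p_ge0 x n t y : 0 <= p x n t y := expansion_ge0 jp x n t y.

Lemma off_diag_sym x y : off_diag mu x y = off_diag mu y x.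
Proof. by rewrite /off_diag eq_sym mu_sym. Qed.

(** The jump part of the generator is symmetric with respect to nu: a jump may be
    made by either of the two factors. *)
Lemma inflow_pairing (a b : nat -> R -> V -> R) (D : seq V) (s t : R) m n :
  \sum_(z <- D) inflow nu mu a D m.+1 s z * (b n t z / nu z) =
  \sum_(z <- D) a m s z * (inflow nu mu b D n.+1 t z / nu z).
Proof.
rewrite /=.
under eq_bigr do rewrite mulr_suml.
rewrite exchange_big/=; apply: eq_bigr => z _.
rewrite mulr_suml mulr_sumr; apply: eq_bigr => w _.
rewrite off_diag_sym; ring.
Qed.

(** The exit terms cancel for each k, and by symmetry the inflow into the first
    factor with k + 1 jumps cancels the inflow into the second one when the first
    has k jumps: the sum telescopes in k. *)
Lemma convolution_derive0 (a b : nat -> R -> V -> R) (D : seq V) (s t : R) n :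
  \sum_(k < n.+1) \sum_(z <- D)
    ((inflow nu mu a D k s z - q z * a k s z) * (b (n - k)%N t z / nu z) +
     a k s z * (- (inflow nu mu b D (n - k) t z - q z * b (n - k)%N t z) * (nu z)^-1)) = 0.
Proof.
have -> : \sum_(k < n.+1) \sum_(z <- D)
    ((inflow nu mu a D k s z - q z * a k s z) * (b (n - k)%N t z / nu z) +
     a k s z * (- (inflow nu mu b D (n - k) t z - q z * b (n - k)%N t z) * (nu z)^-1)) =
  \sum_(k < n.+1) \sum_(z <- D) inflow nu mu a D k s z * (b (n - k)%N t z / nu z) -
  \sum_(k < n.+1) \sum_(z <- D) a k s z * (inflow nu mu b D (n - k) t z / nu z).
  rewrite -sumrB; apply: eq_bigr => k _; rewrite -sumrB.
  by apply: eq_bigr => z _; ring.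
rewrite big_ord_recl/= [X in X + _ - _]big1 ?add0r; last by move=> z _; rewrite mul0r.
rewrite [X in _ - X]big_ord_recr/= subnn [X in _ - (_ + X)]big1 ?addr0; last first.
  by move=> z _; rewrite mul0r mulr0.
apply/eqP; rewrite subr_eq0; apply/eqP; apply: eq_bigr => k _.
rewrite /bump/= add1n inflow_pairing.
by rewrite subnSK.
Qed.

(** The forward equation of the expansion from x at time s and that of the
    expansion from y at time T - s cancel, so the pairing does not depend on s.
    At s = T only z = y contributes.  The case s = 0 is reversibility, and an
    intermediate s is the semigroup property, refined by the number of jumps. *)
Lemma expansion_convolution x y n (D : seq V) (T s : R) : uniq D ->
  (forall m t z, (m <= n)%N -> z \notin D -> p x m t z = 0) ->
  (forall m t z, (m <= n)%N -> z \notin D -> p y m t z = 0) ->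
  0 <= s -> s <= T ->
  \sum_(k < n.+1) \sum_(z <- D) p x k s z * (p y (n - k)%N (T - s) z / nu z) =
  p x n T y / nu y.
Proof.
move=> uD xD yD s0 sT.
pose Phi (r : R) : R := \sum_(k < n.+1) \sum_(z <- D) p x k r z * (p y (n - k)%N (T - r) z / nu z).
suff PhiT : Phi s = Phi T.
  rewrite -/(Phi s) PhiT /Phi subrr.
  rewrite big_ord_recr/= big1 ?add0r => [|k _]; last first.
    rewrite big1// => z _; rewrite (expansion_start jp).
    by rewrite subn_eq0 leqNgt ltn_ord mul0r mulr0.
  rewrite subnn; have [yinD|ynD] := boolP (y \in D); last first.
    rewrite (xD _ _ _ (leqnn n) ynD) mul0r big1_seq// => z /andP[_ zD].
    rewrite (expansion_start jp) eqxx/=; case: eqVneq => [yz|_].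
      by move: ynD; rewrite yz zD.
    by rewrite mul0r mulr0.
  rewrite (bigD1_seq y)//= big1 ?addr0 => [|z zy]; rewrite (expansion_start jp) eqxx/=.
    by rewrite eqxx mul1r.
  by rewrite eq_sym (negPf zy) mul0r mulr0.
apply: derive_eq0_constant => // r sr rT.
  have r0 : 0 < r by exact: le_lt_trans sr.
  have Tr0 : 0 < T - r by rewrite subr_gt0.
  rewrite -(convolution_derive0 (p x) (p y) D r (T - r) n).
  apply: is_derive_bigsum => k; apply: is_derive_bigsum => z.
  apply: is_derive_mul.
    apply: (expansion_derive jp) => // m t w mk; apply: xD.
    by rewrite (leq_trans (ltnW mk))// -ltnS.
  have h : is_derive (T - r) 1 (fun r => p y (n - k)%N r z)
      (inflow nu mu (p y) D (n - k) (T - r) z - q z * p y (n - k)%N (T - r) z).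
    apply: (expansion_derive jp) => // m t w mk; apply: yD.
    by rewrite (leq_trans (ltnW mk))// leq_subr.
  apply: (is_derive_eq (is_derive_mul (is_derive_reflect h) (is_derive_cst (nu z)^-1 r 1))).
  by rewrite mulr0 addr0.
apply: continuous_bigsum => k; apply: continuous_bigsum => z.
apply: continuousM; first exact: (expansion_continuous jp).
apply: continuousM; last exact: cst_continuous.
apply: (@continuous_comp _ _ _ (fun r => T - r) (fun r => p y (n - k)%N r z)).
  by apply: continuousB; [exact: cst_continuous|exact: cvg_id].
exact: (expansion_continuous jp).
Qed.

Definition partial_heat N x t y : R := \sum_(n < N.+1) p x n t y.

Lemma partial_heat_ge0 N x t y : 0 <= partial_heat N x t y.
Proof. by apply: sumr_ge0. Qed.

Lemma partial_heat_pairing x y N (D : seq V) s t :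
  \sum_(z <- D) partial_heat N x s z * (partial_heat N y t z / nu z) =
  \sum_(k < N.+1) \sum_(j < N.+1) \sum_(z <- D) p x k s z * (p y j t z / nu z).
Proof.
under [RHS]eq_bigr do rewrite exchange_big/=.
rewrite [RHS]exchange_big/=; apply: eq_bigr => z _.
rewrite mulr_suml; apply: eq_bigr => k _.
by rewrite mulr_suml mulr_sumr.
Qed.

(** A path with at most N jumps splits at time s into two paths with at most N
    jumps each; the right side also counts the pairs with more than N jumps in
    total. *)
Lemma partial_heat_split x y N (D : seq V) (T s : R) : uniq D ->
  (forall m t z, (m <= N)%N -> z \notin D -> p x m t z = 0) ->
  (forall m t z, (m <= N)%N -> z \notin D -> p y m t z = 0) ->
  0 <= s -> s <= T ->
  partial_heat N x T y / nu y <=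
  \sum_(z <- D) partial_heat N x s z * (partial_heat N y (T - s) z / nu z).
Proof.
move=> uD xD yD s0 sT; rewrite partial_heat_pairing /partial_heat mulr_suml.
pose c k j := \sum_(z <- D) p x k s z * (p y j (T - s) z / nu z).
have c0 k j : 0 <= c k j.
  by apply: sumr_ge0 => z _; rewrite mulr_ge0// divr_ge0// ltW.
rewrite (eq_bigr (fun n : 'I_N.+1 => \sum_(k < n.+1) c k (n - k)%N)); last first.
  move=> n _; rewrite expansion_convolution// => m t z mn; [apply: xD|apply: yD].
    by rewrite (leq_trans mn)// -ltnS.
  by rewrite (leq_trans mn)// -ltnS.
rewrite triangle_sum; apply: ler_sum => k _.
exact: (@ler_sum_ord_widen _ (c k) _ _ (leq_subr _ _)).
Qed.

(** Two paths with at most N jumps each make a loop with at most 2 N jumps. *)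
Lemma partial_heat_merge x N (D : seq V) (s : R) : uniq D ->
  (forall m t z, (m <= N + N)%N -> z \notin D -> p x m t z = 0) ->
  0 <= s ->
  \sum_(z <- D) partial_heat N x s z ^+ 2 / nu z <=
    partial_heat (N + N) x (2 * s) x / nu x.
Proof.
move=> uD xD s0.
pose c k j := \sum_(z <- D) p x k s z * (p x j s z / nu z).
have c0 k j : 0 <= c k j.
  by apply: sumr_ge0 => z _; rewrite mulr_ge0// divr_ge0// ltW.
under eq_bigr do rewrite expr2 -mulrA.
rewrite partial_heat_pairing -/c /partial_heat mulr_suml.
rewrite [leRHS](eq_bigr (fun n : 'I_(N + N).+1 => \sum_(k < n.+1) c k (n - k)%N)); last first.
  have ss : 2 * s - s = s by lra.
  move=> n _; rewrite -(@expansion_convolution x x n D (2 * s) s)//; last 3 first.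
  - by move=> m t z mn; apply: xD; rewrite (leq_trans mn)// -ltnS.
  - by move=> m t z mn; apply: xD; rewrite (leq_trans mn)// -ltnS.
  - by lra.
  by rewrite ss.
rewrite triangle_sum.
apply: (@le_trans _ _ (\sum_(k < N.+1) \sum_(j < (N + N).+1 - k) c k j)).
  apply: ler_sum => k _; apply: (@ler_sum_ord_widen _ (c k)) => //.
  by rewrite leq_subRL ?(leq_trans (ltnW (ltn_ord k)))// ?ltnS ?leq_addr// addnS ltnS leq_add2r -ltnS.
apply: (@ler_sum_ord_widen _ (fun k => \sum_(j < (N + N).+1 - k) c k j)) => [|k].
  by rewrite ltnS leq_addr.
by apply: sumr_ge0.
Qed.

Context (d : V -> V -> R).
Hypothesis mu_ge0 : forall x y, 0 <= mu x y.
Hypothesis d_sym : forall x y, d x y = d y x.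
Hypothesis d_jump : forall x y, 0 < mu x y -> d x y <= 1.
Hypothesis d_sum : forall x (D : seq V), uniq D ->
  \sum_(y <- D) d x y ^+ 2 * mu x y <= nu x.
Hypothesis q_sum : forall x (D : seq V), uniq D ->
  \sum_(y <- D) off_diag mu x y <= q x * nu x.

Section dissipation.
Context (D : seq V) (uD : uniq D) (a u du : V -> R) (c : R).
Hypotheses (c0 : 0 <= c) (a0 : forall z, 0 <= a z) (ca : forall z, c * a z <= 1 / 2).
Hypothesis a_lip : forall z w, `|a z - a w| <= d z w.
Hypothesis u0 : forall z, 0 <= u z.
Hypothesis du_le : forall z,
  du z <= \sum_(w <- D) u w / nu w * off_diag mu w z - q z * u z.
Let e z := expR (- (c * a z ^+ 2)).
Let v z := u z / nu z.

(** The sum is the time derivative of the weighted energy, c being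
    1 / (4 (K - s)).  Symmetrising over the two ends of each edge produces the
    expression of [edge_dissipation], and the condition
    \sum_w d(z,w)^2 mu_zw <= nu_z turns its bound into exactly what the decreasing
    weight gives back. *)
Lemma weighted_dissipation :
  \sum_(z <- D) (2 * (u z * du z) * (e z / nu z) -
                 4 * c ^+ 2 * a z ^+ 2 * (u z * u z * (e z / nu z))) <= 0.
Proof.
have e0 z : 0 < e z by exact: expR_gt0.
have v0 z : 0 <= v z by rewrite divr_ge0// ltW.
have uv z : u z = v z * nu z by rewrite /v divfK// gt_eqF.
have off0 z w : 0 <= off_diag mu z w by rewrite /off_diag; case: ifP.
rewrite sumrB subr_le0.
pose S := \sum_(z <- D) \sum_(w <- D) off_diag mu z w * (e z * v z * (v w - v z)).
apply: (@le_trans _ _ (2 * S)).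
  rewrite mulr_sumr; apply: ler_sum => z _.
  rewrite (_ : 2 * (u z * du z) * (e z / nu z) = 2 * (e z * v z * du z)); last first.
    by rewrite /v; ring.
  rewrite ler_pM2l//; apply: (@le_trans _ _ (e z * v z *
      (\sum_(w <- D) off_diag mu z w * (v w - v z)))); last first.
    by rewrite mulr_sumr; apply: ler_sum => w _; rewrite mulrCA.
  apply: ler_wpM2l; first by rewrite mulr_ge0// ltW.
  apply: (le_trans (du_le z)).
  under [leRHS]eq_bigr do rewrite mulrBr.
  rewrite sumrB lerB//.
    by apply: ler_sum => w _; rewrite off_diag_sym mulrC.
  rewrite -mulr_suml uv mulrA mulrAC.
  by rewrite ler_wpM2r// q_sum.
have S2 : 2 * S = \sum_(z <- D) \sum_(w <- D)
    off_diag mu z w * ((e z * v z - e w * v w) * (v w - v z)).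
  have SS : S = \sum_(z <- D) \sum_(w <- D) off_diag mu z w * (e w * v w * (v z - v w)).
    rewrite /S exchange_big/=; apply: eq_bigr => z _; apply: eq_bigr => w _.
    by rewrite off_diag_sym.
  rewrite (_ : 2 * S = S + S); last by lra.
  rewrite {2}SS -big_split/=; apply: eq_bigr => z _.
  rewrite -big_split/=; apply: eq_bigr => w _; ring.
rewrite S2.
pose K z := 2 * c ^+ 2 * (a z ^+ 2 * v z ^+ 2 * e z).
have Kge0 z : 0 <= K z.
  by apply: mulr_ge0; [|apply: mulr_ge0; last exact: ltW]; rewrite mulr_ge0 ?sqr_ge0.
apply: (@le_trans _ _ (\sum_(z <- D) \sum_(w <- D) d z w ^+ 2 * mu z w * (K z + K w))).
  apply: ler_sum => z _; apply: ler_sum => w _; rewrite /off_diag.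
  case: eqP => [_|_].
    rewrite mul0r; apply: mulr_ge0; last exact: addr_ge0.
    by rewrite mulr_ge0 ?sqr_ge0.
  have [->|mu0] := eqVneq (mu z w) 0; first by rewrite mul0r mulr0 mul0r.
  have mup : 0 < mu z w by rewrite lt_neqAle eq_sym mu0 mu_ge0.
  rewrite [d z w ^+ 2 * _]mulrC -mulrA ler_pM2l//.
  have := @edge_dissipation _ c (d z w) (a z) (a w) (v z) (v w) c0 (a0 z) (a0 w)
    (a_lip z w) (d_jump mup) (ca z) (ca w).
  by rewrite -/(e z) -/(e w) => /le_trans; apply; rewrite /K; lra.
have -> : \sum_(z <- D) \sum_(w <- D) d z w ^+ 2 * mu z w * (K z + K w) =
    2 * \sum_(z <- D) (\sum_(w <- D) d z w ^+ 2 * mu z w) * K z.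
  have h : \sum_(z <- D) \sum_(w <- D) d z w ^+ 2 * mu z w * K w =
      \sum_(z <- D) (\sum_(w <- D) d z w ^+ 2 * mu z w) * K z.
    rewrite exchange_big/=; apply: eq_bigr => z _; rewrite mulr_suml.
    by apply: eq_bigr => w _; rewrite d_sym mu_sym.
  rewrite (_ : 2 * _ = \sum_(z <- D) (\sum_(w <- D) d z w ^+ 2 * mu z w) * K z +
    \sum_(z <- D) (\sum_(w <- D) d z w ^+ 2 * mu z w) * K z); last by lra.
  rewrite -{2}h -big_split/=; apply: eq_bigr => z _.
  by rewrite mulr_suml -big_split/=; apply: eq_bigr => w _; rewrite mulrDr.
rewrite mulr_sumr; apply: ler_sum => z _.
have -> : 4 * c ^+ 2 * a z ^+ 2 * (u z * u z * (e z / nu z)) = 2 * (nu z * K z).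
  by rewrite /K uv; field; rewrite gt_eqF.
by rewrite ler_pM2l// ler_wpM2r// d_sum.
Qed.
End dissipation.

(** The law of the walk with at most N jumps is only a subsolution of the forward
    equation, since mass is lost at the (N+1)-st jump; that has the right sign.
    The shift M/2 keeps c a <= 1/2 for all times up to T. *)
Lemma energy_antitone x N (D : seq V) (a : V -> R) (M T s : R) : uniq D ->
  (forall m t z, (m <= N)%N -> z \notin D -> p x m t z = 0) ->
  0 < M -> (forall z, 0 <= a z) -> (forall z, a z <= M) ->
  (forall z w, `|a z - a w| <= d z w) -> 0 <= s -> s <= T ->
  \sum_(z <- D) partial_heat N x T z ^+ 2 / nu z *
     expR (- ((4 * (T + M / 2 - T))^-1 * a z ^+ 2)) <=
  \sum_(z <- D) partial_heat N x s z ^+ 2 / nu z *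
     expR (- ((4 * (T + M / 2 - s))^-1 * a z ^+ 2)).
Proof.
move=> uD xD M0 a0 aM alip s0 sT.
set K := T + M / 2.
have TK : T < K by rewrite /K; lra.
pose u (r : R) z : R := partial_heat N x r z.
pose c (r : R) : R := (4 * (K - r))^-1.
pose W (r : R) z : R := expR (- (c r * a z ^+ 2)).
pose du (r : R) z : R := \sum_(n < N.+1) (inflow nu mu (p x) D n r z - q z * p x n r z).
pose Phi (r : R) : R := \sum_(z <- D) u r z * u r z * (W r z * (nu z)^-1).
have PhiE r : \sum_(z <- D) partial_heat N x r z ^+ 2 / nu z *
     expR (- ((4 * (K - r))^-1 * a z ^+ 2)) = Phi r.
  by apply: eq_bigr => z _; rewrite /u /W /c expr2 mulrAC mulrA.
rewrite !PhiE.
pose dPhi (r : R) : R := \sum_(z <- D) ((du r z * u r z + u r z * du r z) * (W r z * (nu z)^-1) +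
   u r z * u r z * (W r z * (- (4 * c r ^+ 2 * a z ^+ 2)) * (nu z)^-1 + W r z * 0)).
have uder (r : R) z : 0 < r -> is_derive r 1 (fun r : R => u r z) (du r z).
  move=> r0; apply: is_derive_bigsum => n; apply: (expansion_derive jp) => // m t w mn.
  by apply: xD; rewrite (leq_trans (ltnW mn))// -ltnS.
have Wder (r : R) z : r <= T -> is_derive r 1 (fun r : R => W r z) (W r z * (- (4 * c r ^+ 2 * a z ^+ 2))).
  by move=> rT; apply: is_derive_weight; exact: le_lt_trans TK.
apply: (@derive_le0_antitone _ Phi dPhi) => // r sr rT.
- have r0 : 0 < r by exact: le_lt_trans sr.
  apply: is_derive_bigsum => z; apply: is_derive_mul.
    exact: (is_derive_mul (uder _ _ r0) (uder _ _ r0)).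
  exact: (is_derive_mul (Wder _ z (ltW rT)) (is_derive_cst (nu z)^-1 r 1)).
- have uc z : {for r, continuous (fun r : R => u r z)}.
    by apply: continuous_bigsum => n; exact: (expansion_continuous jp).
  apply: continuous_bigsum => z; apply: continuousM; first exact: continuousM.
  apply: continuousM; last exact: cst_continuous.
  exact: is_derive_continuous (Wder _ z rT).
have r0 : 0 < r by exact: le_lt_trans sr.
have Kr : 0 < K - r by rewrite subr_gt0 (lt_trans rT).
have cr0 : 0 <= c r by rewrite invr_ge0 mulr_ge0// ltW.
have crM : c r * M <= 1 / 2.
  by rewrite /c mulrC ler_pdivrMr ?mulr_gt0// /K; lra.
have car z : c r * a z <= 1 / 2 by apply: le_trans crM; rewrite ler_wpM2l.
have u_ge0 z : 0 <= u r z by exact: partial_heat_ge0.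
have du_le z : du r z <= \sum_(w <- D) u r w / nu w * off_diag mu w z - q z * u r z.
  rewrite /du sumrB -mulr_sumr lerD2r big_ord_recl/= add0r exchange_big/=.
  apply: ler_sum => w _; rewrite /u -!mulr_suml.
  apply: ler_wpM2r; first by rewrite /off_diag; case: ifP.
  apply: ler_wpM2r; first by rewrite invr_ge0 ltW.
  exact: (@ler_sum_ord_widen _ (fun k => p x k r w)).
have := weighted_dissipation uD cr0 a0 car alip u_ge0 du_le.
apply: le_trans; rewrite le_eqVlt; apply/orP; left; apply/eqP.
apply: eq_bigr => z _; rewrite -/(W r z); ring.
Qed.

(** * Tail energy *)

(** The factor nu x makes the value at radius 0 comparable to a return
    probability and at most 1 at time 0. *)
Definition tail_energy N x (D : seq V) (r s : R) : R :=
  nu x * \sum_(z <- D | r <= d x z) partial_heat N x s z ^+ 2 / nu z.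

Hypothesis d_ge0 : forall x y, 0 <= d x y.
Hypothesis d_refl : forall x, d x x = 0.
Hypothesis d_triangle : forall x y z, d x z <= d x y + d y z.

Let d_lip x z w : `|d x z - d x w| <= d z w.
Proof.
rewrite ler_norml; apply/andP; split.
  by have := d_triangle x z w; lra.
by have := d_triangle x w z; rewrite (d_sym w z); lra.
Qed.

Let term_ge0 N x s z : 0 <= partial_heat N x s z ^+ 2 / nu z.
Proof. by rewrite divr_ge0 ?sqr_ge0// ltW. Qed.

Lemma tail_energy0 N x D s :
  tail_energy N x D 0 s = nu x * \sum_(z <- D) partial_heat N x s z ^+ 2 / nu z.
Proof. by congr (_ * _); apply: eq_bigl => z; rewrite d_ge0. Qed.

Lemma tail_energy_mono N x D r s : tail_energy N x D r s <= tail_energy N x D 0 s.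
Proof. by rewrite tail_energy0 ler_pM2l// sum_cond_le. Qed.

(** The maximum principle with a = min (max (r - d(x,.), 0), r - r'): the weight
    is 1 beyond r and reaches its minimum inside r'. *)
Lemma tail_energy_step N x (D : seq V) r r' s s' : uniq D ->
  (forall m t z, (m <= N)%N -> z \notin D -> p x m t z = 0) ->
  0 <= r' -> r' < r -> 0 < s' -> s' < s ->
  tail_energy N x D r s <= tail_energy N x D r' s' +
    expR (- ((r - r') ^+ 2 / (4 * (s - s') + 2 * (r - r')))) * tail_energy N x D 0 s'.
Proof.
move=> uD xD r'0 r'r s'0 s's; pose M := r - r'.
have M0 : 0 < M by rewrite subr_gt0.
pose a z := Num.min (Num.max (r - d x z) 0) M.
have a0 z : 0 <= a z by rewrite /a le_min le_max lexx orbT ltW.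
have aM z : a z <= M by rewrite /a ge_min lexx orbT.
have alip z w : `|a z - a w| <= d z w.
  apply: (le_trans (lip_min _ _ _)); apply: (le_trans (lip_max _ _ _)).
  rewrite (_ : r - d x z - (r - d x w) = - (d x z - d x w)); last by lra.
  by rewrite normrN.
have := energy_antitone uD xD M0 a0 aM alip (ltW s'0) (ltW s's).
set L := \sum_(z <- D) _; set Rr := \sum_(z <- D) _ => LR.
rewrite tail_energy0 /tail_energy mulrCA -mulrDr ler_pM2l//.
apply: (@le_trans _ _ L).
  rewrite big_mkcond/=; apply: ler_sum => z _; case: ifP => [rz|_].
    rewrite (_ : a z = 0) ?expr0n/= ?mulr0 ?oppr0 ?expR0 ?mulr1//.
    by rewrite /a max_r ?subr_le0// min_l// ltW.
  by rewrite mulr_ge0 ?expR_ge0.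
apply: (le_trans LR); rewrite [X in _ <= X + _]big_mkcond/= mulr_sumr -big_split/=.
apply: ler_sum => z _; case: (leP r' (d x z)) => [rz|rz].
  apply: (@le_trans _ _ (partial_heat N x s' z ^+ 2 / nu z)).
    have k0 : 0 <= (4 * (s + M / 2 - s'))^-1.
      by rewrite invr_ge0; move: s's M0 => *; lra.
    have e1 : expR (- ((4 * (s + M / 2 - s'))^-1 * a z ^+ 2)) <= 1.
      by rewrite expR_le1 oppr_le0 mulr_ge0 ?sqr_ge0.
    by rewrite ler_piMr.
  by rewrite lerDl mulr_ge0 ?expR_ge0.
rewrite add0r mulrC ler_wpM2r// ler_expR.
rewrite (_ : a z = M); last first.
  by rewrite /a min_r// le_max; apply/orP; left; rewrite /M lerB// ltW.
by rewrite mulrC (_ : 4 * (s + M / 2 - s') = 4 * (s - s') + 2 * (r - r')) ///M; lra.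
Qed.

(** The maximum principle with a = max (r - d(x,.), 0), started from the point
    mass at x, where a = r. *)
Lemma tail_energy_univ N x (D : seq V) r s : uniq D ->
  (forall m t z, (m <= N)%N -> z \notin D -> p x m t z = 0) ->
  0 < r -> 0 < s ->
  tail_energy N x D r s <= expR (- (r ^+ 2 / (4 * s + 2 * r))).
Proof.
move=> uD xD r0 s0.
pose a z := Num.max (r - d x z) 0.
have a0 z : 0 <= a z by rewrite /a le_max lexx orbT.
have aM z : a z <= r by rewrite /a ge_max (ltW r0) andbT gerBl.
have alip z w : `|a z - a w| <= d z w.
  apply: (le_trans (lip_max _ _ _)).
  rewrite (_ : r - d x z - (r - d x w) = - (d x z - d x w)); last by lra.
  by rewrite normrN.
have := energy_antitone uD xD r0 a0 aM alip (lexx 0) (ltW s0).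
set L := \sum_(z <- D) _ => LR.
rewrite /tail_energy mulrC -ler_pdivlMr//.
apply: (@le_trans _ _ L).
  rewrite big_mkcond/=; apply: ler_sum => z _; case: ifP => [rz|_].
    rewrite (_ : a z = 0) ?expr0n/= ?mulr0 ?oppr0 ?expR0 ?mulr1//.
    by rewrite /a max_r ?subr_le0.
  by rewrite mulr_ge0 ?expR_ge0.
apply: (le_trans LR).
have u0 z : partial_heat N x 0 z = (x == z)%:R.
  rewrite /partial_heat big_ord_recl/= big1 ?addr0 => [|k _]; rewrite (expansion_start jp)//.
apply: (@le_trans _ _ (\sum_(z <- D | z == x)
   (nu x)^-1 * expR (- (r ^+ 2 / (4 * s + 2 * r))))).
  rewrite [leRHS]big_mkcond/=; apply: ler_sum => z _; rewrite u0 eq_sym.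
  case: eqVneq => [->|_]; last by rewrite expr0n/= !mul0r.
  rewrite expr1n mul1r ler_pM2l ?invr_gt0// ler_expR.
  rewrite /a d_refl !subr0 (max_l (ltW r0)) mulrC.
  by rewrite (_ : 4 * (s + r / 2) = 4 * s + 2 * r)//; lra.
rewrite mulrC -big_filter big_const_seq/=.
have [xinD|xnD] := boolP (x \in D).
  by rewrite count_filter (eq_count (a2 := pred1 x)) ?count_uniq_mem ?xinD//= ?addr0// => z; rewrite /= andbb.
have : count predT [seq i <- D | i == x] = 0%N.
  by rewrite count_predT size_filter count_uniq_mem// (negbTE xnD).
by move=> ->/=; rewrite mulr_ge0 ?expR_ge0// invr_ge0 ltW.
Qed.

Lemma tail_energy_diag N x (D : seq V) s : uniq D ->
  (forall m t z, (m <= N + N)%N -> z \notin D -> p x m t z = 0) -> 0 <= s ->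
  tail_energy N x D 0 s <= partial_heat (N + N) x (2 * s) x.
Proof.
move=> uD xD s0; rewrite tail_energy0 mulrC -ler_pdivlMr//.
exact: partial_heat_merge.
Qed.

(** The scalar product of the two laws at time t / 2 is split according to whether
    a vertex is far from x1 or from x2; the law whose starting point is far
    contributes its tail, the other its full energy. *)
Lemma expansion_gaussian_bound (A gamma delta epsilon : R) :
  1 < gamma -> forall C, tail_constant A gamma delta epsilon (8 * 10 ^- 7) C ->
  0 < C ->
  forall (T1 : R) (T2 : \bar R) (x1 x2 : V) (f1 f2 : R -> R) (t : R) N,
  x1 != x2 -> 0 < d x1 x2 -> 0 <= T1 -> (T1%:E < T2)%E ->
  (forall s n, 0 < s -> partial_heat n x1 s x1 <= (f1 s)^-1) ->
  (forall s n, 0 < s -> partial_heat n x2 s x2 <= (f2 s)^-1) ->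
  regular A gamma T1 T2 f1 -> regular A gamma T1 T2 f2 ->
  (forall s, T1 <= s -> (s%:E < T2)%E -> f1 s <= A * expR (delta * s `^ epsilon)) ->
  (forall s, T1 <= s -> (s%:E < T2)%E -> f2 s <= A * expR (delta * s `^ epsilon)) ->
  2 ^+ 9 * delta * T1 `^ (1 + epsilon) <= t -> d x1 x2 <= t ->
  (t%:E < T2)%E -> 0 < t ->
  partial_heat N x1 t x2 <=
    2 * Num.sqrt C * Num.sqrt (nu x2 / nu x1) /
    Num.sqrt (f1 (t / (2 * gamma)) * f2 (t / (2 * gamma))) *
    expR (- (10 ^- 7 * (d x1 x2 ^+ 2 / t))).
Proof.
move=> g1 C tail C0 T1 T2 x1 x2 f1 f2 t N x12 d12 T10 T12
  diag1 diag2 reg1 reg2 grow1 grow2 tT1 dt tT2 t0.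
have [D1 uD1 cov1] := expansion_support jp x1 (N + N).
have [D2 uD2 cov2] := expansion_support jp x2 (N + N).
pose D := undup (D1 ++ D2).
have uD : uniq D by exact: undup_uniq.
have cov1' m s z : (m <= N + N)%N -> z \notin D -> p x1 m s z = 0.
  by rewrite /D mem_undup mem_cat negb_or => mN /andP[zD _]; exact: cov1.
have cov2' m s z : (m <= N + N)%N -> z \notin D -> p x2 m s z = 0.
  by rewrite /D mem_undup mem_cat negb_or => mN /andP[_ zD]; exact: cov2.
have NN : (N <= N + N)%N by rewrite leq_addr.
have cov1N m s z : (m <= N)%N -> z \notin D -> p x1 m s z = 0.
  by move=> mN; apply: cov1'; exact: leq_trans NN.
have cov2N m s z : (m <= N)%N -> z \notin D -> p x2 m s z = 0.
  by move=> mN; apply: cov2'; exact: leq_trans NN.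
pose r := d x1 x2 / 2.
have r0 : 0 < r by rewrite divr_gt0.
have rt : 2 * r <= t by rewrite /r mulrC divfK.
have t20 : 0 < t / 2 by rewrite divr_gt0.
have bound x f : (forall m s z, (m <= N)%N -> z \notin D -> p x m s z = 0) ->
    (forall m s z, (m <= N + N)%N -> z \notin D -> p x m s z = 0) ->
    (forall s n, 0 < s -> partial_heat n x s x <= (f s)^-1) ->
    regular A gamma T1 T2 f ->
    (forall s, T1 <= s -> (s%:E < T2)%E -> f s <= A * expR (delta * s `^ epsilon)) ->
    tail_energy N x D r (t / 2) <=
      C / f (t / (2 * gamma)) * expR (- (r ^+ 2 / t * (8 * 10 ^- 7))) /\
    tail_energy N x D 0 (t / 2) <= (f (t / (2 * gamma)))^-1.
  move=> xD xDD diag reg grow.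
  have diagJ s : 0 < s -> tail_energy N x D 0 s <= (f (2 * s))^-1.
    move=> s0; apply: (le_trans (tail_energy_diag uD xDD (ltW s0))).
    by apply: diag; rewrite mulr_gt0.
  split.
    apply: (tail (tail_energy N x D) f T1 T2) => //.
    - by move=> *; exact: tail_energy_step.
    - by move=> *; exact: tail_energy_mono.
    - by move=> *; exact: tail_energy_univ.
  apply: (le_trans (diagJ _ t20)).
  have [_ f_gt0 f_nd _] := reg.
  have g0 : 0 < gamma by lra.
  have tg0 : 0 < t / (2 * gamma) by rewrite divr_gt0// mulr_gt0.
  rewrite [2 * _]mulrC divfK// lef_pV2 ?posrE ?f_gt0//.
  apply: f_nd; first exact: ltW.
  by rewrite ler_pdivrMr ?mulr_gt0// ler_pMr//; lra.
have [tail1 full1] := bound _ _ cov1N cov1' diag1 reg1 grow1.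
have [tail2 full2] := bound _ _ cov2N cov2' diag2 reg2 grow2.
have [_ f1_gt0 _ _] := reg1; have [_ f2_gt0 _ _] := reg2.
have g0 : 0 < gamma by lra.
have tg0 : 0 < t / (2 * gamma) by rewrite divr_gt0// mulr_gt0.
move: tail1 full1 tail2 full2 (f1_gt0 _ tg0) (f2_gt0 _ tg0).
set F1 := f1 _; set F2 := f2 _; set E := expR (- (r ^+ 2 / t * _)).
move=> tail1 full1 tail2 full2 F10 F20.
have E0 : 0 < E by exact: expR_gt0.
pose al x F := Num.sqrt (C / F * E / nu x).
pose be x F := Num.sqrt (F^-1 / nu x).
have alp x F : 0 < F -> 0 < C / F * E / nu x.
  by move=> F0; rewrite divr_gt0// mulr_gt0// divr_gt0.
have bep x F : 0 < F -> 0 < F^-1 / nu x.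
  by move=> F0; rewrite divr_gt0// invr_gt0.
have al_gt0 x F : 0 < F -> 0 < al x F by move=> F0; rewrite sqrtr_gt0 alp.
have be_gt0 x F : 0 < F -> 0 < be x F by move=> F0; rewrite sqrtr_gt0 bep.
have alE x F : 0 < F -> al x F ^+ 2 = C / F * E / nu x.
  by move=> F0; rewrite sqr_sqrtr// ltW// alp.
have beE x F : 0 < F -> be x F ^+ 2 = F^-1 / nu x.
  by move=> F0; rewrite sqr_sqrtr// ltW// bep.
pose h x z := partial_heat N x (t / 2) z.
have tailE x F : 0 < F -> tail_energy N x D r (t / 2) <= C / F * E ->
    \sum_(z <- D | r <= d x z) h x z ^+ 2 * (nu z)^-1 <= al x F ^+ 2.
  by move=> F0; rewrite alE// /tail_energy mulrC -ler_pdivlMr.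
have fullE x F (P : pred V) : 0 < F -> tail_energy N x D 0 (t / 2) <= F^-1 ->
    \sum_(z <- D | P z) h x z ^+ 2 * (nu z)^-1 <= be x F ^+ 2.
  move=> F0; rewrite beE// tail_energy0 mulrC -ler_pdivlMr// => /(le_trans _); apply.
  by apply: sum_cond_le => z; rewrite mulr_ge0 ?sqr_ge0// invr_ge0 ltW.
have nui z : 0 <= (nu z)^-1 by rewrite invr_ge0 ltW.
have S1 : \sum_(z <- D | r <= d x1 z) h x1 z * h x2 z * (nu z)^-1 <= al x1 F1 * be x2 F2.
  apply: sum_mul_le_of_sqr => //; [exact: al_gt0|exact: be_gt0|exact: tailE|exact: fullE].
have S2 : \sum_(z <- D | r <= d x2 z) h x1 z * h x2 z * (nu z)^-1 <= be x1 F1 * al x2 F2.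
  apply: sum_mul_le_of_sqr => //; [exact: be_gt0|exact: al_gt0|exact: fullE|exact: tailE].
have h0 x z : 0 <= h x z by exact: partial_heat_ge0.
have total : partial_heat N x1 t x2 / nu x2 <= al x1 F1 * be x2 F2 + be x1 F1 * al x2 F2.
  apply: (le_trans (partial_heat_split uD cov1N cov2N (ltW t20) _)); first by lra.
  have -> : t - t / 2 = t / 2 by lra.
  apply: (le_trans _ (lerD S1 S2)).
  rewrite [X in _ <= X + _]big_mkcond [X in _ <= _ + X]big_mkcond -big_split/=.
  apply: ler_sum => z _; rewrite mulrA -/(h x1 z) -/(h x2 z).
  have g00 : 0 <= h x1 z * h x2 z * (nu z)^-1 by rewrite !mulr_ge0.
  have tri := d_triangle x1 z x2; rewrite (d_sym z x2) in tri.
  case: (leP r (d x1 z)) => [_|r1]; first by rewrite lerDl; case: ifP.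
  rewrite add0r; case: (leP r (d x2 z)) => // r2.
  by move: r1 r2 tri; rewrite /r; lra.
rewrite ler_pdivrMr// in total; apply: (le_trans total).
(* r = d / 2 divides the exponent by 4 and the square root by 2, whence the rate
   8 * 10^-7 for the tails. *)
have sqE : Num.sqrt E = expR (- (10 ^- 7 * (d x1 x2 ^+ 2 / t))).
  have -> : E = expR (- (10 ^- 7 * (d x1 x2 ^+ 2 / t))) ^+ 2.
    rewrite -expRM_natl /E; congr expR; rewrite /r.
    by field; rewrite gt_eqF.
  by rewrite sqrtr_sqr ger0_norm// expR_ge0.
have albe x y F G : 0 < F -> 0 < G ->
    al x F * be y G = Num.sqrt C * Num.sqrt E / (Num.sqrt (F * G) * Num.sqrt (nu x * nu y)).
  move=> F0 G0.
  have p1 := alp x F F0; have p2 : 0 < F * G by exact: mulr_gt0.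
  have p3 : 0 < nu x * nu y by exact: mulr_gt0.
  rewrite /al /be -sqrtrM ?(ltW p1)// -sqrtrM ?(ltW C0)// -sqrtrM ?(ltW p2)//.
  rewrite -sqrtrV ?(ltW (mulr_gt0 p2 p3))// -sqrtrM ?(ltW (mulr_gt0 C0 E0))//; congr Num.sqrt.
  by field; rewrite !gt_eqF.
rewrite (mulrC (be x1 F1)) !albe// -sqE [nu x2 * nu x1]mulrC [F2 * F1]mulrC.
have nn : Num.sqrt (nu x2 / nu x1) = nu x2 / Num.sqrt (nu x1 * nu x2).
  have n0 : 0 < Num.sqrt (nu x1 * nu x2) by rewrite sqrtr_gt0 mulr_gt0.
  have p1 : 0 <= nu x2 / Num.sqrt (nu x1 * nu x2) by rewrite divr_ge0// ltW.
  have p2 : 0 <= nu x2 / nu x1 by rewrite divr_ge0// ltW.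
  have p3 : 0 <= nu x1 * nu x2 by rewrite mulr_ge0// ltW.
  apply/eqP; rewrite -(@eqrXn2 _ 2%N) ?sqrtr_ge0//.
  rewrite expr_div_n !sqr_sqrtr//.
  by apply/eqP; field; rewrite !gt_eqF.
rewrite nn le_eqVlt; apply/orP; left; apply/eqP.
have n0 : 0 < Num.sqrt (nu x1 * nu x2) by rewrite sqrtr_gt0 mulr_gt0.
have f0 : 0 < Num.sqrt (F1 * F2) by rewrite sqrtr_gt0 mulr_gt0.
by field; rewrite !gt_eqF.
Qed.

End expansion_theory.

(** * Rates and neighbourhoods on a locally finite graph *)

Lemma sum_subseq_le (R : realType) (V : eqType) (D D' : seq V) (F : V -> R) :
  uniq D -> uniq D' -> {subset D <= D'} -> (forall z, 0 <= F z) ->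
  \sum_(z <- D) F z <= \sum_(z <- D') F z.
Proof.
move=> uD uD' sub F0.
have -> : \sum_(z <- D) F z = \sum_(z <- D' | z \in D) F z.
  rewrite -[RHS]big_filter; apply: perm_big; apply: uniq_perm => //.
    exact: filter_uniq.
  by move=> z; rewrite mem_filter; case: (boolP (z \in D)) => // /sub ->.
by rewrite big_mkcond/=; apply: ler_sum => z _; case: ifP.
Qed.

Lemma sum_support_widen (R : realType) (V : eqType) (D D' : seq V) (F : V -> R) : uniq D -> uniq D' ->
  {subset D <= D'} -> (forall z, z \notin D -> F z = 0) ->
  \sum_(z <- D') F z = \sum_(z <- D) F z.
Proof.
move=> uD uD' sub F0; rewrite [RHS](_ : _ = \sum_(z <- D' | z \in D) F z).
  rewrite [RHS]big_mkcond/=; apply: eq_bigr => z _.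
  by case: (boolP (z \in D)) => // /F0.
rewrite -[RHS]big_filter; apply: perm_big; apply: uniq_perm => //.
  exact: filter_uniq.
by move=> z; rewrite mem_filter; case: (boolP (z \in D)) => // /sub ->.
Qed.
Section graph_rates.
Context {R : realType} {V : choiceType} (E : rel V) (nu : V -> R) (mu : V -> V -> R).
Hypotheses (gE : graph E) (mE : edge_weight E mu) (nu_gt0 : forall x, 0 < nu x).

Lemma neighbours_exist :
  exists nb : V -> seq V, (forall x, uniq (nb x)) /\ forall x y, E x y = (y \in nb x).
Proof.
have h x : {s : seq V | uniq s /\ forall y, E x y = (y \in s)}.
  apply: cid; have /finite_seqP[s hs] := graph_locally_finite gE x.
  exists (undup s); split; first exact: undup_uniq.
  move=> y; rewrite mem_undup; apply/idP/idP.
    by move=> xy; have : [set y | E x y] y by []; rewrite hs.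
  by move=> ys; have : [set` s] y by []; rewrite -hs.
by exists (fun x => sval (h x)); split=> x; have [] := svalP (h x).
Qed.

Lemma edge_weight_ge0 x y : 0 <= mu x y.
Proof.
case: (boolP (E x y)) => [/(edge_weight_gt0 mE)/ltW//|].
by move=> /(edge_weight_eq0 mE) ->.
Qed.

Lemma rate_off x y : x != y -> rate nu mu x y = mu x y / nu x.
Proof.
move=> xy; rewrite /rate /generator (negPf xy) (fsbigE [:: y])//; last first.
  by move=> z _; rewrite inE => /negPf ->; rewrite subrr mul0r.
by rewrite big_mkcond/= big_seq1 in_setT eqxx subr0 mul1r mulrC.
Qed.

Lemma exit_rate_sum x (D : seq V) : uniq D -> (forall y, E x y -> y \in D) ->
  exit_rate nu mu x * nu x = \sum_(y <- D) off_diag mu x y.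
Proof.
move=> uD cov; rewrite /exit_rate /rate /generator eqxx (fsbigE D)//; last first.
  move=> z _ zD; rewrite (edge_weight_eq0 mE) ?mulr0//.
  by apply: contra zD; exact: cov.
rewrite -mulrN mulrC mulrA divff ?mul1r ?gt_eqF// -sumrN.
rewrite big_mkcond/=; apply: eq_bigr => z _; rewrite in_setT /off_diag eq_sym.
by case: eqVneq => _; rewrite ?subrr ?mul0r ?oppr0// sub0r mulN1r opprK.
Qed.

Lemma off_diag_ge0 x y : 0 <= off_diag mu x y.
Proof. by rewrite /off_diag; case: ifP => // _; exact: edge_weight_ge0. Qed.

Lemma exit_rate_ge_sum x (D : seq V) : uniq D ->
  \sum_(y <- D) off_diag mu x y <= exit_rate nu mu x * nu x.
Proof.
move=> uD; have [nb [unb nbE]] := neighbours_exist.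
rewrite (@exit_rate_sum x (undup (D ++ nb x))) ?undup_uniq//; last first.
  by move=> y; rewrite mem_undup mem_cat nbE => ->; rewrite orbT.
apply: sum_subseq_le; rewrite ?undup_uniq//; last by move=> z; exact: off_diag_ge0.
by move=> y yD; rewrite mem_undup mem_cat yD.
Qed.

Lemma adapted_sum_le d x (D : seq V) : adapted_metric E nu mu d -> uniq D ->
  \sum_(y <- D) d x y ^+ 2 * mu x y <= nu x.
Proof.
move=> ad uD; have [nb [unb nbE]] := neighbours_exist.
have := adapted_sum ad x; rewrite (fsbigE (undup (D ++ nb x))) ?undup_uniq//; last first.
  move=> z _; rewrite mem_undup mem_cat negb_or -nbE => /andP[_ xz].
  by rewrite (edge_weight_eq0 mE) ?mulr0.
rewrite mulrC ler_pdivrMr// mul1r; apply: le_trans.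
rewrite [leRHS]big_mkcond/=.
under [leRHS]eq_bigr do rewrite in_setT.
apply: sum_subseq_le; rewrite ?undup_uniq//.
  by move=> y yD; rewrite mem_undup mem_cat yD.
by move=> z; rewrite mulr_ge0 ?sqr_ge0 ?edge_weight_ge0.
Qed.

(** The first step of a path to another vertex that leaves x is an edge that is
    not a loop. *)
Lemma exit_rate_gt0 x y : x != y -> 0 < exit_rate nu mu x.
Proof.
move=> xy; have [p Ep lp] := graph_connected gE x y.
have [z xz Exz] : exists2 z, x != z & E x z.
  elim: p x xy Ep lp => [x /eqP xy _ /= //|z p IH x xy /= /andP[Exz Ep] lp].
  have [xz|xz] := eqVneq x z; last by exists z.
  by apply: IH => //; rewrite xz.
have : 0 < exit_rate nu mu x * nu x.
  apply: (lt_le_trans _ (@exit_rate_ge_sum x [:: z] isT)).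
  by rewrite big_seq1 /off_diag (negPf xz) (edge_weight_gt0 mE).
by rewrite pmulr_lgt0.
Qed.

Lemma jump_prob_ge0 x y : 0 <= jump_prob nu mu x y.
Proof.
have q0 : 0 <= exit_rate nu mu x.
  by have := @exit_rate_ge_sum x [::] isT; rewrite big_nil pmulr_lge0.
rewrite /jump_prob; case: ifP => // _; case: eqVneq => // xy.
by rewrite divr_ge0// rate_off// divr_ge0 ?edge_weight_ge0// ltW.
Qed.

(** Balls of the graph distance are finite and exhaust a connected graph. *)
Lemma vertices_countable : countable [set: V].
Proof.
have [[x _]|] := pselect (exists x : V, True); last first.
  move=> nex; rewrite (_ : [set: V] = set0) ?countable0//.
  by apply/seteqP; split=> // x _; case: nex; exists x.
have [nb [_ nbE]] := neighbours_exist.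
pose ball n := iter n (fun s => s ++ flatten (map nb s)) [:: x].
have inball p : path E x p -> last x p \in ball (size p).
  elim/last_ind: p => [|p y IH]; first by rewrite /= inE.
  rewrite rcons_path last_rcons size_rcons /= => /andP[/IH hp Ey].
  rewrite mem_cat; apply/orP; right; apply/flattenP.
  by exists (nb (last x p)); [exact: map_f|rewrite -nbE].
rewrite (_ : [set: V] = \bigcup_n [set` ball n]).
  by apply: bigcup_countable => // n _; exact/finite_set_countable/finite_seq.
apply/seteqP; split=> // y _; have [p Ep <-] := graph_connected gE x y.
by exists (size p) => //=; exact: inball.
Qed.

End graph_rates.

(** * Exponential clocks and the memoryless property *)

Lemma exponential_prob_tail (R : realType) (a : R) : 0 <= a ->
  exponential_prob 1 `]a, +oo[%classic = (expR (- a))%:E.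
Proof.
move=> a0; rewrite /exponential_prob integral_itv_obnd_cbnd; last first.
  apply/measurable_EFinP/measurable_funTS; exact: measurable_exponential_pdf.
have cont : continuous (fun z : R => - expR (- 1 * z)).
  move=> z; apply: (is_derive_continuous (a := expR (- 1 * z))).
  have h1 := is_derive_mul (is_derive_cst (- 1 : R) z 1) (is_derive_id z 1).
  have h2 := is_deriveN (is_derive1_comp (is_derive_expR _) h1).
  by apply: (is_derive_eq h2); rewrite /= mul0r add0r mulr1 mulrN1 opprK.
rewrite (@ge0_continuous_FTC2y _ _ (fun x => - (expR (- 1 * x))) _ 0)//.
- by rewrite -EFinB sub0r opprK mulN1r.
- by move=> x _; apply: exponential_pdf_ge0.
- apply: (@continuous_subspaceW R^o _ _ [set` `[0, +oo[%R]).
    by move=> x /=; rewrite !in_itv/= !andbT; exact: le_trans.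
  exact: within_continuous_exponential_pdf.
- rewrite -oppr0; apply: cvgN.
  rewrite (_ : (fun x => expR (- 1 * x)) = (fun z => expR (- z))); last first.
    by apply/funext => x; rewrite mulN1r.
  exact: cvgr_expR.
- by apply: cvg_at_right_filter; exact: cont.
- move=> x; rewrite in_itv/= andbT => ax; apply: derive1_exponential_pdf.
  by rewrite in_itv/= andbT (le_lt_trans a0).
Qed.

Section restricted_law.
Context {R : realType} d (Om : measurableType d) (P : probability Om R).
Context (D : set Om) (mD : measurable D).

(** The joint behaviour of f and a fixed event D is recorded as a finite measure,
    to which uniqueness of product measures can be applied. *)
Lemma restricted_law d' (T : measurableType d') (f : Om -> T) :
  measurable_fun setT f ->
  exists m : {finite_measure set T -> \bar R},
    forall B, m B = P (f @^-1` B `&` D).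
Proof.
move=> mf; pose m : {measure set T -> \bar R} := pushforward (mrestr P mD) f.
have fin : (m mf setT < +oo)%E.
  rewrite /m /= /pushforward /mrestr preimage_setT setTI.
  by rewrite -ge0_fin_numE// fin_num_measure.
exists (mfrestr measurableT fin) => B.
by rewrite -[LHS]/(m mf (B `&` setT)) setIT.
Qed.

End restricted_law.

(** The exponential law is transported to the canonical measurable structure of
    R, the one carried by random variables. *)
Lemma exponential_prob_measure (R : realType) :
  exists m : {finite_measure set R -> \bar R}, forall B, m B = exponential_prob 1 B.
Proof.
pose m : probability (measurableTypeR R) R := exponential_prob 1.
have [e eE] := @restricted_law R _ _ (m ltr01) setT measurableT _ R idfun
  (@measurable_id _ _ setT).
by exists e => B; rewrite eE setIT.
Qed.

Section independence.
Context {R : realType} d (Om : measurableType d) (P : probability Om R).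
Context (D : set Om) (mD : measurable D).

(** Two finite measures that agree on a family closed under intersection agree on
    the sigma-algebra it generates. *)
Lemma independence_extend (D2 : set Om) (G : set (set Om)) (c : R) : measurable D2 ->
  0 <= c -> G `<=` measurable -> G setT -> setI_closed G ->
  (forall A, G A -> P (A `&` D) = (c%:E * P (A `&` D2))%E) ->
  forall A, <<s G >> A -> P (A `&` D) = (c%:E * P (A `&` D2))%E.
Proof.
move=> mD2 c0 Gm GT GI eqG A sA.
pose cc : {nonneg R} := NngNum c0.
have := @g_sigma_algebra_measure_unique _ R Om G Gm (fun _ => setT) (fun _ => GT)
  _ (mrestr P mD) (mscale cc (mrestr P mD2)) GI _ _ A sA.
apply.
- by apply/seteqP; split => // x _; exists 0%N.
- by move=> B GB; rewrite /mscale /mrestr /=; exact: eqG.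
- by move=> _; rewrite -[X in (X < _)%E]/(P (setT `&` D)) setTI -ge0_fin_numE// fin_num_measure.
Qed.

(** On D the pair (S, H) has a product law.  By Fubini it suffices to fix the
    arrival time r <= s; both events are then tails of H, at q (s + h - r) and
    q (s - r). *)
Lemma memoryless (S H : Om -> R) (q s h : R) :
  measurable_fun setT S -> measurable_fun setT H -> 0 < q -> 0 <= h ->
  (forall B B', measurable B -> measurable B' ->
    P (S @^-1` B `&` H @^-1` B' `&` D) =
    (P (S @^-1` B `&` D) * exponential_prob 1 B')%E) ->
  P ([set w | (S w <= s /\ s + h < S w + H w / q)%R] `&` D) =
  ((expR (- (q * h)))%:E * P ([set w | (S w <= s /\ s < S w + H w / q)%R] `&` D))%E.
Proof.
move=> mS mH q0 h0 indep.
have [m1 m1E] := restricted_law P mD mS.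
have mSH : measurable_fun setT (fun w => (S w, H w)) by exact: measurable_fun_pair.
have [m mE] := restricted_law P mD mSH.
have [e eE] := exponential_prob_measure R.
have rect A B : measurable A -> measurable B -> m (A `*` B) = (m1 A * e B)%E.
  move=> mA mB; rewrite m1E eE -indep// mE; congr (P (_ `&` _)).
have uniq := product_measure_unique rect.
pose X u : set (R * R) := [set p | p.1 <= s /\ u < p.1 + p.2 / q].
have mX u : measurable (X u).
  rewrite (_ : X u = (fst @^-1` `]-oo, s]%classic) `&`
     ((fun p : R * R => p.1 + p.2 * q^-1) @^-1` `]u, +oo[%classic)); last first.
    by apply/seteqP; split => -[a b]; rewrite /X/= !in_itv/= andbT.
  apply: measurableI.
    by rewrite -[X in measurable X]setTI; exact: measurable_fst.
  rewrite -[X in measurable X]setTI.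
  have : measurable_fun setT (fun p : R * R => p.1 + p.2 * q^-1).
    apply: measurable_funD; first exact: measurable_fst.
    apply: measurable_funM; [exact: measurable_snd|exact: measurable_cst].
  by apply.
have PX u : P ([set w | (S w <= s /\ u < S w + H w / q)%R] `&` D) = (m1 \x e)%E (X u).
  by rewrite (uniq _ (mX u)); exact/esym/mE.
pose g (r : R) : \bar R := if r <= s then (expR (- (q * (s - r))))%:E else 0%E.
have secE k r : 0 <= k -> e (xsection (X (s + k)) r) = ((expR (- (q * k)))%:E * g r)%E.
  move=> k0; rewrite /g; case: ifPn => rs.
    rewrite (_ : xsection _ _ = `]q * (s + k - r), +oo[%classic); last first.
      apply/seteqP; split => z; rewrite /xsection /X/= in_itv/= andbT inE/=.
        by move=> [_]; rewrite -ltrBlDl ltr_pdivlMr// mulrC.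
      by move=> hz; split => //; rewrite -ltrBlDl ltr_pdivlMr// mulrC.
    rewrite eE exponential_prob_tail; last by rewrite mulr_ge0 ?(ltW q0)//; lra.
    by rewrite -EFinM -expRD; congr (expR _)%:E; ring.
  rewrite mule0 (_ : xsection _ _ = set0) ?measure0//.
  apply/seteqP; split => z //; rewrite /xsection /X/= inE/= => -[rs'].
  by rewrite rs' in rs.
have mg : measurable_fun setT g.
  have := @measurable_fun_xsection _ _ _ _ _ e _ (mX (s + 0)).
  apply: eq_measurable_fun => r _; rewrite /= secE// mulr0 oppr0 expR0 mul1e.
  by [].
have g0 r : (0 <= g r)%E by rewrite /g; case: ifP => // _; rewrite lee_fin expR_ge0.
rewrite PX (_ : [set w | S w <= s /\ s < _] = [set w | S w <= s /\ s + 0 < S w + H w / q]); last first.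
  by rewrite addr0.
rewrite PX /product_measure1.
under eq_integral do rewrite /= secE//.
rewrite ge0_integralZl ?lee_fin ?expR_ge0//.
congr (_ * _)%E.
by apply: eq_integral => r _; rewrite /= secE// mulr0 oppr0 expR0 mul1e.
Qed.

End independence.

(** * Probabilities as real numbers *)

Section fine_probability.
Context {R : realType} d (Om : measurableType d) (m : probability Om R).

Lemma probabilityE A : measurable A -> m A = (fine (m A))%:E.
Proof. by move=> mA; rewrite fineK// fin_num_measure. Qed.

Lemma fine_probability_mono A B : measurable A -> measurable B -> A `<=` B ->
  fine (m A) <= fine (m B).
Proof.
move=> mA mB AB; apply: fine_le; rewrite ?fin_num_measure//.
by apply: le_measure => //; rewrite inE.
Qed.

Lemma fine_probability_le1 A : measurable A -> fine (m A) <= 1.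
Proof.
move=> mA; rewrite -lee_fin -probabilityE//; exact: probability_le1.
Qed.

Lemma fine_probability_split A B C : measurable B -> measurable C ->
  A = B `|` C -> B `&` C = set0 -> fine (m A) = fine (m B) + fine (m C).
Proof.
move=> mB mC -> BC; rewrite measureU// fineD// fin_num_measure//.
Qed.

End fine_probability.

Lemma exponential_probT (R : realType) : fine (exponential_prob 1 [set: R]) = 1.
Proof. by rewrite /exponential_prob integral_exponential_pdf. Qed.

Lemma exponential_prob_cdf (R : realType) (a : R) : 0 <= a ->
  fine (exponential_prob 1 `]-oo, a]%classic) = 1 - expR (- a).
Proof.
move=> a0; have [e eE] := exponential_prob_measure R.
have e1 : fine (e setT) = 1 by rewrite eE exponential_probT.
have : e setT = (e `]-oo, a]%classic + e `]a, +oo[%classic)%E.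
  rewrite -measureU//.
    by congr (e _); apply/seteqP; split => // x _ /=; rewrite !in_itv/= andbT; case: leP; [left|right].
  apply/seteqP; split => // x [/=]; rewrite !in_itv/= andbT => h1 h2.
  by move: (lt_le_trans h2 h1); rewrite ltxx.
have e2 : fine (e `]a, +oo[%classic) = expR (- a) by rewrite eE exponential_prob_tail.
move=> /(congr1 fine); rewrite fineD ?fin_num_measure// e1 e2 eE => h.
by apply/eqP; rewrite eq_sym subr_eq; exact/eqP.
Qed.

(** * Independence of the clocks from the past of the walk *)

Section walk.
Context {R : realType} {V : choiceType} (nu : V -> R) (mu : V -> V -> R).
Context disp (Om : measurableType disp) (P : V -> probability Om R).
Context (X : R -> Om -> option V) (Y : nat -> Om -> V) (H : nat -> Om -> R).
Hypothesis walk : minimal_walk_data nu mu P X Y H.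
Hypothesis V_countable : countable [set: V].
Hypothesis q_gt0 : forall x, 0 < exit_rate nu mu x.
Local Notation q := (exit_rate nu mu).
Local Notation J := (jump_prob nu mu).
Hypothesis J_ge0 : forall x y, 0 <= J x y.

(** The time of the n-th jump, as a real number: all exit rates are positive. *)
Definition arrival n w : R := \sum_(k < n) H k w / q (Y k w).

Let mY n y : measurable [set w | Y n w = y].
Proof. exact: minwalk_measurable_chain walk n y. Qed.

Let mH n : measurable_fun setT (H n).
Proof. exact: minwalk_measurable_clock walk n. Qed.

Let mHB n B : measurable B -> measurable (H n @^-1` B).
Proof. by move=> mB; rewrite -[X in measurable X]setTI; exact: mH. Qed.

(** V carries no measurable structure, so statements about Y k are decomposed over
    its countably many fibres. *)
Lemma fibre_cover k : exists F : nat -> set Om,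
  [/\ trivIset setT F, forall A, A = \bigcup_i (A `&` F i) &
      forall i, F i = set0 \/ exists z, F i = [set w | Y k w = z]].
Proof.
have /countable_injP[f finj] := V_countable.
exists (fun i => [set w | f (Y k w) = i]); split.
- by apply/trivIsetP => i j _ _ ij; apply/seteqP; split => // w [/= -> /eqP]; rewrite (negPf ij).
- move=> A; apply/seteqP; split => [w Aw|w [i _ []]//].
  by exists (f (Y k w)).
move=> i; have [[z fz]|nz] := pselect (exists z, f z = i).
  right; exists z; apply/seteqP; split => w /=; rewrite -fz; last by move->.
  by apply: finj; rewrite in_setT.
by left; apply/seteqP; split => // w fw; apply: nz; exists (Y k w).
Qed.

Lemma measurable_fibrewise k A :
  (forall z, measurable (A `&` [set w | Y k w = z])) -> measurable A.
Proof.
move=> mA; have [F [_ cover FE]] := fibre_cover k.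
rewrite (cover A); apply: bigcupT_measurable => i.
by have [->|[z ->]] := FE i; [rewrite setI0; exact: measurable0|exact: mA].
Qed.

Lemma probability_fibrewise k (m : probability Om R) A B (c : R) : 0 <= c ->
  measurable A -> measurable B ->
  (forall z, m (A `&` [set w | Y k w = z]) = (c%:E * m (B `&` [set w | Y k w = z]))%E) ->
  m A = (c%:E * m B)%E.
Proof.
move=> c0 mA mB AB; have [F [tF cover FE]] := fibre_cover k.
have mF i : measurable (F i).
  by have [->|[z ->]] := FE i; [exact: measurable0|exact: mY].
have tI C : trivIset setT (fun i => C `&` F i).
  apply/trivIsetP => i j _ _ ij; rewrite setIACA setIid.
  by move/trivIsetP : tF => /(_ i j Logic.I Logic.I ij) ->; rewrite setI0.
have sumE C : measurable C -> m C = (\sum_(i <oo) m (C `&` F i))%E.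
  move=> mC; rewrite [in LHS](cover C); apply: measure_semi_bigcup => //.
  - by move=> i; exact: measurableI.
  - by rewrite -cover.
rewrite (sumE _ mA) (sumE _ mB) -nneseriesZl//.
apply: eq_eseriesr => i _.
by have [->|[z ->]] := FE i; [rewrite !setI0 measure0 mule0|exact: AB].
Qed.

Lemma measurable_arrival n : measurable_fun setT (arrival n).
Proof.
apply: measurable_sum => k _ B mB; rewrite setTI.
apply: (measurable_fibrewise (k := k)) => z.
rewrite (_ : _ `&` _ = (fun w => H k w * (q z)^-1) @^-1` B `&` [set w | Y k w = z]).
  apply: measurableI => //; rewrite -[X in measurable X]setTI.
  by apply: (measurable_funM (mH k) (measurable_cst _)).
by apply/seteqP; split => w /= [+ e]; rewrite e.
Qed.

(** The events that constrain the first n + 1 clocks separately, a family closed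
    under intersection. *)
Definition clock_events n : set (set Om) :=
  [set A | exists B : nat -> set R, (forall k, measurable (B k)) /\
    A = [set w | forall k, (k <= n)%N -> B k (H k w)]].

Lemma clock_events_measurable n : clock_events n `<=` measurable.
Proof.
move=> A [B [mB ->]].
rewrite (_ : [set w | _] = \bigcap_(k in [set k | (k <= n)%N]) (H k @^-1` B k)); last first.
  by apply/seteqP; split.
apply: bigcap_measurable => [|k _]; first by exists 0%N.
by rewrite -[X in measurable X]setTI; exact: mH.
Qed.

Lemma clock_events_setT n : clock_events n setT.
Proof.
by exists (fun=> setT); split => //; apply/seteqP; split.
Qed.

Lemma clock_events_setI n : setI_closed (clock_events n).
Proof.
move=> _ _ [B [mB ->]] [C [mC ->]]; exists (fun k => B k `&` C k); split.
  by move=> k; exact: measurableI.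
apply/seteqP; split => [w [hB hC] k kn|w h]; first by split; [exact: hB|exact: hC].
by split => k kn; have [] := h k kn.
Qed.

(** Along a fixed path of the chain, the arrival time is a linear combination of
    the clocks. *)
Lemma clock_sum_event n (a : nat -> R) C : measurable C ->
  <<s clock_events n >> [set w | C (\sum_(k < n.+1) H k w * a k)].
Proof.
move=> mC.
pose T : measurableType _ := g_sigma_algebraType (clock_events n).
have mHT (k : 'I_n.+1) : measurable_fun [set: T] (H k : T -> R).
  move=> _ B mB; rewrite setTI; apply: sub_sigma_algebra.
  exists (fun j => if j == k :> nat then B else setT); split.
    by move=> j; case: ifP.
  apply/seteqP; split => w /=.
    by move=> HB j jn; case: eqP => // ->.
  by move=> /(_ k); rewrite eqxx; apply; rewrite -ltnS.
have : measurable_fun [set: T] (fun w : T => \sum_(k < n.+1) H k w * a k).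
  apply: measurable_sum => k; apply: measurable_funM; first exact: mHT.
  exact: measurable_cst.
by move=> /(_ measurableT _ mC); rewrite setTI.
Qed.

Lemma measurable_window (pth : nat -> V) j n :
  measurable [set w | forall k, (j <= k <= n)%N -> Y k w = pth k].
Proof.
rewrite (_ : [set w | _] = \bigcap_(k in [set k | (j <= k <= n)%N]) [set w | Y k w = pth k]).
  have [jn|jn] := leqP j n; last first.
    rewrite (_ : [set k | _] = set0) ?bigcap_set0//.
    apply/seteqP; split => // k /= /andP[jk kn].
    by have := leq_trans jk kn; rewrite leqNgt jn.
  apply: bigcap_measurable => [|k _]; last exact: mY.
  by exists j; rewrite /= leqnn.
by apply/seteqP; split.
Qed.

(** For events of the generating family this is the law of the walk with one more
    step; it extends to the generated sigma-algebra. *)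
Lemma walk_law_path x n (pth : nat -> V) z B A : measurable B ->
  <<s clock_events n >> A ->
  P x (A `&` ([set w | forall k, (0 <= k <= n)%N -> Y k w = pth k] `&`
       [set w | Y n.+1 w = z /\ B (H n.+1 w)])) =
  ((J (pth n) z * fine (exponential_prob 1 B))%:E *
   P x (A `&` [set w | forall k, (0 <= k <= n)%N -> Y k w = pth k]))%E.
Proof.
move=> mB; have [e eE] := exponential_prob_measure R.
have e0 : (0 <= fine (exponential_prob 1 B)) by rewrite -eE fine_ge0.
apply: independence_extend => //.
- apply: measurableI; first exact: measurable_window.
  exact: (measurableI _ _ (mY _ _) (mHB _ mB)).
- exact: measurable_window.
- by rewrite mulr_ge0.
- exact: clock_events_measurable.
- exact: clock_events_setT.
- exact: clock_events_setI.
move=> _ [C [mC ->]].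
pose pth' k := if k == n.+1 then z else pth k.
pose C' k := if k == n.+1 then B else C k.
have mC' k : measurable (C' k) by rewrite /C'; case: ifP.
have := minwalk_law walk x n pth mC; have := minwalk_law walk x n.+1 pth' mC'.
have neq k : (k <= n)%N -> (k == n.+1) = false by move=> kn; rewrite ltn_eqF.
have -> : [set w | forall k, (k <= n.+1)%N -> Y k w = pth' k /\ C' k (H k w)] =
  [set w | forall k, (k <= n)%N -> C k (H k w)] `&`
  ([set w | forall k, (0 <= k <= n)%N -> Y k w = pth k] `&`
   [set w | Y n.+1 w = z /\ B (H n.+1 w)]).
  apply/seteqP; split => [w h|w [h1 [h2 [h3 h4]]] k].
    split; first by move=> k kn; have := h k (leqW kn); rewrite /C' neq// => -[].
    split; last by have := h n.+1 (leqnn _); rewrite /pth' /C' eqxx.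
    by move=> k /= kn; have := h k (leqW kn); rewrite /pth' neq// => -[].
  rewrite leq_eqVlt => /orP[/eqP ->|]; first by rewrite /pth' /C' eqxx.
  by rewrite ltnS => kn; rewrite /pth' /C' neq//; split; [exact: h2|exact: h1].
have -> : [set w | forall k, (k <= n)%N -> Y k w = pth k /\ C k (H k w)] =
  [set w | forall k, (k <= n)%N -> C k (H k w)] `&`
  [set w | forall k, (0 <= k <= n)%N -> Y k w = pth k].
  apply/seteqP; split => [w h|w [h1 h2] k kn]; last by split; [exact: h2|exact: h1].
  by split => k kn; have [] := h k kn.
move=> -> ->.
rewrite big_ord_recr/= [X in (_ * X)%E]big_ord_recr/=.
rewrite /pth' eqxx neq// [C' n.+1]/C' eqxx.
rewrite (eq_bigr (fun k : 'I_n => J (pth k) (pth k.+1))); last first.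
  by move=> k _; rewrite /pth' neq ?(ltnW (ltn_ord k))// neq.
have -> : (\prod_(k < n.+1) exponential_prob 1 (C' k) =
          \prod_(k < n.+1) exponential_prob 1 (C k))%E.
  by apply: eq_bigr => k _; rewrite /C' neq// -ltnS.
have eB : exponential_prob 1 B = (fine (exponential_prob 1 B))%:E.
  by rewrite fineK// -eE fin_num_measure.
by rewrite eB /= (neq n (leqnn n)) mulrA EFinM muleACA [(J _ _ * _)%:E]EFinM muleC.
Qed.

Let mA n C : measurable C -> measurable (arrival n @^-1` C).
Proof. by move=> mC; rewrite -[X in measurable X]setTI; exact: measurable_arrival. Qed.

Let e_ge0 (B : set R) : 0 <= fine (exponential_prob 1 B).
Proof. by have [e eE] := exponential_prob_measure R; rewrite -eE fine_ge0. Qed.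

Let exponential_probE (B : set R) : measurable B ->
  exponential_prob 1 B = (fine (exponential_prob 1 B))%:E.
Proof.
by move=> mB; have [e eE] := exponential_prob_measure R; rewrite fineK// -eE fin_num_measure.
Qed.

(** With the whole path up to n prescribed, the arrival time is a function of the
    clocks and [walk_law_path] applies.  The induction on j then releases the
    constraints Y k = pth k for k < j, one index at a time. *)
Lemma walk_law_step x n y z C B : measurable C -> measurable B ->
  P x ([set w | C (arrival n.+1 w)] `&` [set w | Y n w = y] `&`
       [set w | Y n.+1 w = z /\ B (H n.+1 w)]) =
  ((J y z * fine (exponential_prob 1 B))%:E *
   P x ([set w | C (arrival n.+1 w)] `&` [set w | Y n w = y]))%E.
Proof.
move=> mC mB; pose W j pth := [set w | forall k, (j <= k <= n)%N -> Y k w = pth k].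
pose L := [set w | Y n.+1 w = z /\ B (H n.+1 w)].
have mL : measurable L by exact: (measurableI _ _ (mY _ _) (mHB _ mB)).
suff Q j pth : (j <= n)%N ->
    P x ([set w | C (arrival n.+1 w)] `&` W j pth `&` L) =
    ((J (pth n) z * fine (exponential_prob 1 B))%:E *
     P x ([set w | C (arrival n.+1 w)] `&` W j pth))%E.
  have := Q n (fun=> y) (leqnn n).
  rewrite (_ : W n (fun=> y) = [set w | Y n w = y])//.
  apply/seteqP; split => [w /(_ n)|w /= Yn k]; first by rewrite leqnn; apply.
  by rewrite -eqn_leq => /eqP <-.
elim: j pth => [|j IH] pth jn.
  have clk : <<s clock_events n >> [set w | C (\sum_(k < n.+1) H k w * (q (pth k))^-1)].
    exact: (@clock_sum_event n (fun k => (q (pth k))^-1) C mC).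
  have := walk_law_path x pth z mB clk; rewrite -/(W 0%N pth) -/L.
  rewrite (_ : [set w | C (arrival n.+1 w)] `&` W 0%N pth =
    [set w | C (\sum_(k < n.+1) H k w * (q (pth k))^-1)] `&` W 0%N pth); last first.
    have aE w : W 0%N pth w -> arrival n.+1 w = \sum_(k < n.+1) H k w * (q (pth k))^-1.
      by move=> Ww; apply: eq_bigr => k _; rewrite Ww//= -ltnS.
    by apply/seteqP; split => w [/= Cw Ww]; split => //=; move: Cw; rewrite aE.
  by rewrite setIA.
apply: (@probability_fibrewise j).
- by rewrite mulr_ge0.
- by apply: measurableI => //; apply: measurableI; [exact: mA|exact: measurable_window].
- by apply: measurableI; [exact: mA|exact: measurable_window].
move=> v; pose pth' k := if k == j then v else pth k.
have WE : W j.+1 pth `&` [set w | Y j w = v] = W j pth'.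
  apply/seteqP; split => [w [Ww Yj] k /andP[jk kn]|w Ww].
    rewrite /pth'; case: eqP => [->//|/eqP kj].
    by apply: Ww; rewrite kn andbT ltn_neqAle eq_sym kj.
  split.
    move=> k /andP[jk kn]; rewrite Ww ?(ltnW jk)//.
    by rewrite /pth' gtn_eqF.
  by rewrite /= Ww ?leqnn ?(ltnW jn)// /pth' eqxx.
have := IH pth' (ltnW jn); rewrite -WE.
have -> : pth' n = pth n by rewrite /pth' gtn_eqF.
rewrite (setIA [set w | C (arrival n.+1 w)]) => h.
by rewrite (setIAC _ L).
Qed.

(** Comparison of [walk_law_step] for the event B and for the full line, summed
    over the previous position. *)
Lemma walk_clock_independent x n y C B : measurable C -> measurable B ->
  P x ([set w | C (arrival n w)] `&` [set w | B (H n w)] `&` [set w | Y n w = y]) =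
  (P x ([set w | C (arrival n w)] `&` [set w | Y n w = y]) * exponential_prob 1 B)%E.
Proof.
move=> mC mB; rewrite [RHS]muleC (exponential_probE mB).
case: n => [|n].
  have aE w : arrival 0 w = 0 by rewrite /arrival big_ord0.
  have start B' : measurable B' -> P x ([set w | Y 0%N w = y] `&` [set w | B' (H 0%N w)]) =
     ((y == x)%:R%:E * exponential_prob 1 B')%E.
    move=> mB'; have := minwalk_law walk x 0%N (fun=> y) (fun _ : nat => mB').
    rewrite big_ord0 mulr1 big_ord1 => <-; congr (P x _).
    apply/seteqP; split => w /=; first by move=> [h1 h2] k; rewrite leqn0 => /eqP ->.
    by move=> /(_ 0%N) -[].
  have [C0|C0] := pselect (C 0).
    rewrite (_ : [set w | C (arrival 0 w)] = setT); last first.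
      by apply/seteqP; split => // w _ /=; rewrite aE.
    rewrite !setTI setIC start// (exponential_probE mB).
    have := start setT measurableT.
    rewrite (_ : [set w | [set: R] (H 0%N w)] = setT)// setIT => ->.
    by rewrite (exponential_probE measurableT) exponential_probT mule1 muleC.
  rewrite (_ : [set w | C (arrival 0 w)] = set0); last first.
    by apply/seteqP; split => // w /=; rewrite aE.
  by rewrite !set0I measure0 mule0.
apply: (@probability_fibrewise n) => //.
- apply: measurableI => //; apply: measurableI; [exact: mA|exact: mHB].
- apply: measurableI => //; exact: mA.
move=> v.
have := walk_law_step x n v y mC mB.
have := walk_law_step x n v y mC measurableT.
rewrite exponential_probT mulr1.
rewrite (_ : [set w | Y n.+1 w = y /\ [set: R] (H n.+1 w)] = [set w | Y n.+1 w = y]); last first.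
  by apply/seteqP; split => w /= [].
rewrite setIAC => h1 h2.
rewrite h1 muleA -EFinM [fine _ * _]mulrC -h2; congr (P x _).
by apply/seteqP; split => w /=; tauto.
Qed.

(** * Occupation probabilities and the forward equations *)

Definition occupied x n t y : R :=
  fine (P x [set w | (arrival n w <= t /\ t < arrival n.+1 w) /\ Y n w = y]).
Definition arrived x n t y : R := fine (P x [set w | arrival n w <= t /\ Y n w = y]).
Definition departed x n t y : R := fine (P x [set w | arrival n.+1 w <= t /\ Y n w = y]).

Lemma arrivalS n w : arrival n.+1 w = arrival n w + H n w / q (Y n w).
Proof. by rewrite /arrival big_ord_recr. Qed.

Lemma arrival_ltS n w : arrival n w < arrival n.+1 w.
Proof. by rewrite arrivalS ltrDl divr_gt0// (minwalk_clock_gt0 walk). Qed.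

Let mle n t : measurable [set w | arrival n w <= t].
Proof.
rewrite (_ : [set w | _] = arrival n @^-1` `]-oo, t]%classic); first exact: mA.
by apply/seteqP; split => w /=; rewrite in_itv.
Qed.

Let mgt n t : measurable [set w | t < arrival n w].
Proof.
rewrite (_ : [set w | _] = arrival n @^-1` `]t, +oo[%classic); first exact: mA.
by apply/seteqP; split => w /=; rewrite in_itv/= andbT.
Qed.

Let mocc n s t y : measurable [set w | (arrival n w <= s /\ t < arrival n.+1 w) /\ Y n w = y].
Proof. exact: (measurableI _ _ (measurableI _ _ (mle n s) (mgt n.+1 t)) (mY n y)). Qed.

Let marr n m t y : measurable [set w | arrival n w <= t /\ Y m w = y].
Proof. exact: (measurableI _ _ (mle n t) (mY m y)). Qed.

Let mbetween n m k s t y :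
  measurable [set w | (s < arrival n w /\ arrival m w <= t) /\ Y k w = y].
Proof. exact: (measurableI _ _ (measurableI _ _ (mgt n s) (mle m t)) (mY k y)). Qed.

Lemma arrivedE x n t y : arrived x n t y = occupied x n t y + departed x n t y.
Proof.
apply: fine_probability_split => //.
  apply/seteqP; split => w /=.
    by move=> [h1 h2]; case: (leP (arrival n.+1 w) t) => h; [right|left].
  by move=> [[[? _] ?]//|[h ?]]; split => //; apply: le_trans h; exact/ltW/arrival_ltS.
apply/seteqP; split => // w /= [[[_ h1] _] [h2 _]].
by move: (lt_le_trans h1 h2); rewrite ltxx.
Qed.

(** Lack of memory of the clock running at y. *)
Lemma survive x n s h y : 0 <= h ->
  fine (P x [set w | (arrival n w <= s /\ s + h < arrival n.+1 w) /\ Y n w = y]) =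
  expR (- (q y * h)) * occupied x n s y.
Proof.
move=> h0; have indep B B' : measurable B -> measurable B' ->
    P x (arrival n @^-1` B `&` H n @^-1` B' `&` [set w | Y n w = y]) =
    (P x (arrival n @^-1` B `&` [set w | Y n w = y]) * exponential_prob 1 B')%E.
  exact: walk_clock_independent.
have := memoryless (mY n y) s (measurable_arrival n) (mH n) (q_gt0 y) h0 indep.
have setE u : [set w | arrival n w <= s /\ u < arrival n w + H n w / q y] `&`
    [set w | Y n w = y] =
    [set w | (arrival n w <= s /\ u < arrival n.+1 w) /\ Y n w = y].
  by apply/seteqP; split => w /= [[h1 h2] h3]; split => //; split => //; move: h2; rewrite arrivalS h3.
rewrite !setE => ->.
by rewrite /occupied (probabilityE (P x) (mocc n s s y)) -EFinM.
Qed.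

(** Those who leave during (s, s + h] were present at time s, or both arrive and
    leave in between. *)
Lemma departed_increment x n s h y : 0 <= h ->
  departed x n (s + h) y - departed x n s y =
  (1 - expR (- (q y * h))) * occupied x n s y +
  fine (P x [set w | (s < arrival n w /\ arrival n.+1 w <= s + h) /\ Y n w = y]).
Proof.
move=> h0.
have st : s <= s + h by rewrite lerDl.
have e1 : occupied x n s y =
   fine (P x [set w | (arrival n w <= s /\ s + h < arrival n.+1 w) /\ Y n w = y]) +
   fine (P x ([set w | arrival n w <= s] `&`
      [set w | (s < arrival n.+1 w /\ arrival n.+1 w <= s + h) /\ Y n w = y])).
  apply: fine_probability_split => //.
  - by apply: measurableI.
  - apply/seteqP; split => w /=.
      move=> [[h1 h2] h3]; case: (leP (arrival n.+1 w) (s + h)) => h4; [right|left] => //.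
    by move=> [[[h1 h2] h3]|[h1 [[h2 h3] h4]]]; split => //; split => //; exact: le_lt_trans h2.
  - apply/seteqP; split => // w /= [[[_ h1] _] [_ [[_ h2] _]]].
    by move: (lt_le_trans h1 h2); rewrite ltxx.
have e2 : departed x n (s + h) y = departed x n s y +
   fine (P x [set w | (s < arrival n.+1 w /\ arrival n.+1 w <= s + h) /\ Y n w = y]).
  apply: fine_probability_split => //.
    apply/seteqP; split => w /=.
      by move=> [h1 h2]; case: (leP (arrival n.+1 w) s) => h3; [left|right].
    by move=> [[h1 h2]|[[h1 h2] h3]]; split => //; exact: le_trans st.
  apply/seteqP; split => // w /= [[h1 _] [[h2 _] _]].
  by move: (lt_le_trans h2 h1); rewrite ltxx.
have e3 : fine (P x [set w | (s < arrival n.+1 w /\ arrival n.+1 w <= s + h) /\ Y n w = y]) =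
   fine (P x ([set w | arrival n w <= s] `&`
      [set w | (s < arrival n.+1 w /\ arrival n.+1 w <= s + h) /\ Y n w = y])) +
   fine (P x [set w | (s < arrival n w /\ arrival n.+1 w <= s + h) /\ Y n w = y]).
  apply: fine_probability_split => //.
  - by apply: measurableI.
  - apply/seteqP; split => w /=.
      by move=> [[h1 h2] h3]; case: (leP (arrival n w) s) => h4; [left|right].
    move=> [[_ //]|[[h1 h2] h3]]; split => //; split => //.
    by apply: (lt_trans h1); exact: arrival_ltS.
  - apply/seteqP; split => // w /= [[h1 _] [[h2 _] _]].
    by move: (lt_le_trans h2 h1); rewrite ltxx.
rewrite survive// in e1; rewrite e2 e3; lra.
Qed.

Lemma departed_increment_ge x n s h y : 0 <= h ->
  (1 - expR (- (q y * h))) * occupied x n s y <=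
  departed x n (s + h) y - departed x n s y.
Proof. by move=> h0; rewrite departed_increment// lerDl fine_ge0. Qed.

(** Those who both arrive and leave in (s, s + h] arrive there and have a clock
    shorter than q h; the two are independent.  The contribution is of second
    order, being at most the increment of the arrivals times q h. *)
Lemma departed_increment_le x n s h y : 0 <= h ->
  departed x n (s + h) y - departed x n s y <=
  (1 - expR (- (q y * h))) * (arrived x n (s + h) y - arrived x n s y + occupied x n s y).
Proof.
move=> h0; rewrite departed_increment// mulrDr addrC lerD2r.
have st : s <= s + h by rewrite lerDl.
have qh0 : 0 <= q y * h by rewrite mulr_ge0// ltW.
have e1 : arrived x n (s + h) y = arrived x n s y +
    fine (P x [set w | (s < arrival n w /\ arrival n w <= s + h) /\ Y n w = y]).
  apply: fine_probability_split => //.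
    apply/seteqP; split => w /=.
      by move=> [h1 h2]; case: (leP (arrival n w) s) => h3; [left|right].
    by move=> [[h1 h2]|[[h1 h2] h3]]; split => //; exact: le_trans st.
  apply/seteqP; split => // w /= [[h1 _] [[h2 _] _]].
  by move: (lt_le_trans h2 h1); rewrite ltxx.
rewrite e1 [arrived x n s y + _]addrC addrK.
have mC : measurable (`]s, s + h]%classic : set R) by [].
have mB : measurable (`]-oo, q y * h]%classic : set R) by [].
have := walk_clock_independent x n y mC mB => /(congr1 fine).
rewrite fineM; last 2 first.
- by apply: fin_num_measure; exact: (measurableI _ _ (mA n mC) (mY n y)).
- by rewrite exponential_probE.
rewrite exponential_prob_cdf// [in RHS]mulrC.
rewrite (_ : [set w | `]s, s + h]%classic (arrival n w)] `&` [set w | Y n w = y] =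
  [set w | (s < arrival n w /\ arrival n w <= s + h) /\ Y n w = y]); last first.
  by apply/seteqP; split => w /=; rewrite in_itv/= => -[/andP].
move=> <-; apply: fine_probability_mono => //.
  exact: (measurableI _ _ (measurableI _ _ (mA n mC) (mHB n mB)) (mY n y)).
move=> w /= [[h1 h2] h3]; split => //; split; rewrite in_itv/=.
  by rewrite h1 (le_trans _ h2)//; exact/ltW/arrival_ltS.
rewrite arrivalS h3 in h2.
have : H n w / q y <= h by lra.
by rewrite ler_pdivrMr// mulrC.
Qed.

Context (E : rel V).
Hypotheses (gE : graph E) (mE : edge_weight E mu).

Lemma jump_prob_rate y z : J y z * q y = off_diag mu y z / nu y.
Proof.
rewrite /jump_prob gt_eqF// /off_diag.
by case: (eqVneq y z) => [_|yz]; rewrite ?mul0r// rate_off// divfK// gt_eqF.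
Qed.

Lemma jump_prob_eq0 y z : ~~ E y z -> J y z = 0.
Proof.
move=> yz; have : J y z * q y = 0.
  rewrite jump_prob_rate /off_diag; case: ifP => _; rewrite ?mul0r//.
  by rewrite (edge_weight_eq0 mE yz) mul0r.
by move=> /eqP; rewrite mulf_eq0 (gt_eqF (q_gt0 y)) orbF => /eqP.
Qed.

Lemma arrival_gt0 n w : 0 < arrival n.+1 w.
Proof.
elim: n => [|n IH]; last exact: (lt_trans IH (arrival_ltS _ _)).
by have := arrival_ltS 0 w; rewrite {1}/arrival big_ord0.
Qed.

Let mnotin k (D : seq V) : measurable [set w | Y k w \notin D].
Proof.
apply: (@measurable_fibrewise k) => z; have [zD|zD] := boolP (z \in D).
  rewrite (_ : _ `&` _ = set0)//.
  by apply/seteqP; split => // w /= [+ e]; rewrite e zD.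
rewrite (_ : _ `&` _ = [set w | Y k w = z])//.
by apply/seteqP; split => w /=; [case|move=> e; split => //; rewrite e].
Qed.

(** The neighbours of a vertex form a finite set, so the position before a jump is
    split over finitely many fibres and a remainder. *)
Lemma fibre_sum x k A (D : seq V) : measurable A -> uniq D ->
  fine (P x A) = \sum_(y <- D) fine (P x (A `&` [set w | Y k w = y])) +
    fine (P x (A `&` [set w | Y k w \notin D])).
Proof.
move=> mA'; elim: D => [_|y D IH /= /andP[yD uD]].
  by rewrite big_nil add0r; congr (fine (P x _)); apply/seteqP; split => w // [].
rewrite big_cons {}IH//.
suff -> : fine (P x (A `&` [set w | Y k w \notin D])) =
    fine (P x (A `&` [set w | Y k w = y])) +
    fine (P x (A `&` [set w | Y k w \notin y :: D])) by rewrite addrCA addrA.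
apply: fine_probability_split.
- by apply: measurableI.
- by apply: measurableI.
- apply/seteqP; split => w /=; rewrite inE negb_or.
    by move=> [Aw wD]; have [/eqP e|ne] := boolP (Y k w == y); [left|right].
  by move=> [[Aw e]|[Aw /andP[_ ?]]]; split => //; rewrite e.
- apply/seteqP; split => // w /= [[_ e] [_]]; rewrite inE negb_or e eqxx//.
Qed.

(** Whoever has made the (n+1)-st jump to z has left a neighbour of z; the
    destination is independent of the departure time. *)
Lemma arrivedS x n t z (D : seq V) : uniq D -> (forall y, E y z -> y \in D) ->
  arrived x n.+1 t z = \sum_(y <- D) J y z * departed x n t y.
Proof.
move=> uD cov.
pose A := [set w | arrival n.+1 w <= t /\ Y n.+1 w = z].
have mAA : measurable A by exact: marr.
have step y : fine (P x (A `&` [set w | Y n w = y])) = J y z * departed x n t y.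
  have mC : measurable (`]-oo, t]%classic : set R) by [].
  have := walk_law_step x n y z mC measurableT => /(congr1 fine).
  rewrite exponential_probT mulr1 fineM//; last first.
    by apply: fin_num_measure; exact: (measurableI _ _ (mA n.+1 mC) (mY n y)).
  rewrite /= /departed => h.
  rewrite (_ : A `&` _ = [set w | `]-oo, t]%classic (arrival n.+1 w)] `&`
    [set w | Y n w = y] `&` [set w | Y n.+1 w = z /\ [set: R] (H n.+1 w)]).
    by rewrite h; congr (_ * fine (P x _)).
  apply/seteqP; split => w /=; first by move=> [[h1 h2] h3]; rewrite in_itv.
  by rewrite in_itv => -[[h1 h2] [h3 _]].
rewrite /arrived -/A (@fibre_sum x n A D mAA uD).
under eq_bigr do rewrite step.
suff -> : fine (P x (A `&` [set w | Y n w \notin D])) = 0 by rewrite addr0.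
have := @probability_fibrewise n (P x) (A `&` [set w | Y n w \notin D]) setT 0 (lexx 0).
rewrite mul0e => -> //; first by apply: measurableI.
move=> v; rewrite mul0e.
have [vD|vD] := boolP (v \in D).
  rewrite (_ : _ `&` _ = set0)//; apply/seteqP; split => // w /= [[_ +] e].
  by rewrite e vD.
apply/eqP; rewrite eq_le measure_ge0 andbT.
have : (P x (A `&` [set w | Y n w = v]) <= 0)%E.
  rewrite (probabilityE (P x)); last by apply: measurableI.
  by rewrite step jump_prob_eq0 ?mul0r//; apply: contra vD; exact: cov.
apply: le_trans; apply: le_measure; rewrite ?inE.
- by apply: measurableI => //; apply: measurableI.
- by apply: measurableI.
- by move=> w /= [[Aw _] e].
Qed.

Lemma arrived0 x t y : 0 <= t -> arrived x 0 t y = (x == y)%:R.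
Proof.
move=> t0; have := minwalk_law walk x 0%N (fun=> y) (fun _ : nat => @measurableT _ R).
rewrite big_ord0 mulr1 big_ord1 exponential_probE// exponential_probT mule1 eq_sym => h.
rewrite /arrived (_ : [set w | _] = [set w | forall k, (k <= 0)%N -> Y k w = y /\ [set: R] (H k w)]).
  by rewrite h.
apply/seteqP; split => w /=.
  by move=> [_ e] k; rewrite leqn0 => /eqP ->.
by move=> /(_ 0%N (leqnn _)) [-> _]; split => //; rewrite /arrival big_ord0.
Qed.

(** Time is clamped at 0, which makes these functions continuous on the whole
    line. *)
Definition jumps x n t y : R := occupied x n (Num.max t 0) y.

Lemma jumps_start x n y : jumps x n 0 y = ((n == 0%N) && (x == y))%:R.
Proof.
rewrite /jumps maxxx; case: n => [|n] /=.
  have := arrivedE x 0 0 y; rewrite arrived0// => ->.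
  rewrite /departed (_ : [set w | _] = set0) ?measure0 ?addr0//.
  by apply/seteqP; split => // w /= [h]; move: (arrival_gt0 0 w); rewrite ltNge h.
rewrite /occupied (_ : [set w | _] = set0) ?measure0//.
by apply/seteqP; split => // w /= [[h _] _]; move: (arrival_gt0 n w); rewrite ltNge h.
Qed.

Lemma arrived_mono x n s h y : 0 <= h -> arrived x n s y <= arrived x n (s + h) y.
Proof.
move=> h0; apply: fine_probability_mono => // w /= [h1 h2]; split => //.
by apply: (le_trans h1); rewrite lerDl.
Qed.

(** A vertex is left at a bounded rate.  Continuity is needed first, as
    [clock_derivative] takes the continuity of the arrivals and of the occupation
    probability for granted. *)
Lemma departed_lipschitz x n s t y : 0 <= s -> 0 <= t ->
  `|departed x n s y - departed x n t y| <= 2 * q y * `|s - t|.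
Proof.
move=> s0 t0; wlog st : s t s0 t0 / t <= s.
  move=> hw; have [|/ltW] := leP t s; first exact: hw.
  by move=> st; rewrite distrC [`|s - t|]distrC; exact: hw.
have h0 : 0 <= s - t by rewrite subr_ge0.
have tE : s = t + (s - t) by rewrite addrC subrK.
have lo := departed_increment_ge x n t y h0.
have up := departed_increment_le x n t y h0; rewrite -tE in lo up.
have qh : 0 <= q y * (s - t) by rewrite mulr_ge0// ltW.
have [e1 e2] := expR_compl_bounds qh.
have e0 : 0 <= 1 - expR (- (q y * (s - t))).
  by rewrite subr_ge0 expR_le1 oppr_le0.
have G0 : 0 <= occupied x n t y by exact: fine_ge0.
rewrite ger0_norm; last by apply: le_trans lo; exact: mulr_ge0.
rewrite (ger0_norm h0); apply: (le_trans up).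
have F1 : arrived x n s y <= 1 by exact: fine_probability_le1.
have G1 : occupied x n t y <= 1 by exact: fine_probability_le1.
have F0 : 0 <= arrived x n t y by exact: fine_ge0.
have FF : 0 <= arrived x n s y - arrived x n t y + occupied x n t y.
  have Fm := arrived_mono x n t y h0; rewrite -tE in Fm.
  by rewrite addr_ge0// subr_ge0.
rewrite (_ : 2 * q y * (s - t) = q y * (s - t) * 2); last by ring.
by apply: ler_pM => //; lra.
Qed.

Lemma departed_continuous x n y (t : R) :
  {for t, continuous (fun s : R => departed x n (Num.max s 0) y)}.
Proof.
apply: (@lipschitz_continuous_at _ _ (2 * q y)); first by rewrite mulr_ge0// ltW.
move=> s; apply: (le_trans (departed_lipschitz _ _ _ _ _)); rewrite ?le_max ?lexx ?orbT//.
by rewrite ler_wpM2l ?lip_max// mulr_ge0// ltW.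
Qed.

Lemma arrived_continuous x n y (t : R) :
  {for t, continuous (fun s : R => arrived x n (Num.max s 0) y)}.
Proof.
case: n => [|n].
  rewrite (_ : (fun _ => _) = cst (x == y)%:R); first exact: cst_continuous.
  by apply/funext => s; rewrite arrived0// le_max lexx orbT.
have [nb [unb nbE]] := neighbours_exist gE.
rewrite (_ : (fun _ => _) =
    (fun s => \sum_(z <- nb y) J z y * departed x n (Num.max s 0) z)); last first.
  apply/funext => s; apply: arrivedS => // z zy.
  by rewrite -nbE (graph_sym gE).
apply: continuous_bigsum => z; apply: continuousM; first exact: cst_continuous.
exact: departed_continuous.
Qed.

Lemma jumpsE x n t y :
  jumps x n t y = arrived x n (Num.max t 0) y - departed x n (Num.max t 0) y.
Proof. by rewrite arrivedE addrK. Qed.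

Lemma jumps_continuous x n y (t : R) : {for t, continuous (fun s : R => jumps x n s y)}.
Proof.
rewrite (_ : (fun _ => _) =
    (fun s => arrived x n (Num.max s 0) y - departed x n (Num.max s 0) y)).
  by apply: continuousB; [exact: arrived_continuous|exact: departed_continuous].
by apply/funext => s; rewrite jumpsE.
Qed.

Lemma departed_derive x n y (t : R) : 0 < t ->
  is_derive t 1 (fun s : R => departed x n (Num.max s 0) y) (q y * jumps x n t y).
Proof.
move=> t0.
have maxE s : 0 <= s -> Num.max s 0 = s by move=> s0; rewrite max_l.
apply: (@clock_derivative _ (q y) t (fun s => departed x n (Num.max s 0) y)
   (fun s => jumps x n s y) (fun s => arrived x n (Num.max s 0) y)) => //.
- move=> s h s0 h0; rewrite /jumps !maxE ?addr_ge0//.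
  exact: departed_increment_ge.
- move=> s h s0 h0; rewrite /jumps !maxE ?addr_ge0//.
  exact: departed_increment_le.
- by move=> s; exact: fine_ge0.
- by move=> s h s0 h0; rewrite !maxE ?addr_ge0// arrived_mono.
- exact: jumps_continuous.
- exact: arrived_continuous.
Qed.

Lemma jumps_derive x n y (t : R) (D : seq V) : 0 < t -> uniq D ->
  (forall m s z, (m < n)%N -> z \notin D -> jumps x m s z = 0) ->
  is_derive t 1 (fun s : R => jumps x n s y)
    (inflow nu mu (jumps x) D n t y - q y * jumps x n t y).
Proof.
move=> t0 uD cov.
have der_arr : is_derive t 1 (fun s : R => arrived x n (Num.max s 0) y)
    (inflow nu mu (jumps x) D n t y).
  case: n cov => [_|n cov].
    rewrite (_ : (fun _ => _) = cst (x == y)%:R); first exact: is_derive_cst.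
    by apply/funext => s; rewrite arrived0// le_max lexx orbT.
  have [nb [unb nbE]] := neighbours_exist gE.
  pose D' := undup (D ++ nb y).
  have uD' : uniq D' by exact: undup_uniq.
  rewrite (_ : (fun _ => _) =
      (fun s => \sum_(z <- D') J z y * departed x n (Num.max s 0) z)); last first.
    apply/funext => s; apply: arrivedS => // z zy.
    by rewrite mem_undup mem_cat -nbE (graph_sym gE) zy orbT.
  have -> : inflow nu mu (jumps x) D n.+1 t y =
      \sum_(z <- D') (0 * departed x n (Num.max t 0) z + J z y * (q z * jumps x n t z)).
    rewrite /= (@sum_support_widen _ _ D D') => //.
    - apply: eq_bigr => z _; rewrite mul0r add0r mulrA jump_prob_rate; ring.
    - by move=> z zD; rewrite mem_undup mem_cat zD.
    - by move=> z zD; rewrite cov// !mulr0 mul0r addr0.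
  apply: is_derive_bigsum => z.
  exact: (is_derive_mul (is_derive_cst (J z y) t 1) (departed_derive x n z t0)).
rewrite (_ : (fun _ => _) =
    (fun s => arrived x n (Num.max s 0) y - departed x n (Num.max s 0) y)).
  exact: (is_deriveB der_arr (departed_derive x n y t0)).
by apply/funext => s; rewrite jumpsE.
Qed.

(** Only vertices joined to the starting point by a path of length at most N are
    reached with N jumps. *)
Lemma arrived_support x N : exists2 D : seq V, uniq D &
  forall n t y, (n <= N)%N -> 0 <= t -> y \notin D -> arrived x n t y = 0.
Proof.
have [nb [unb nbE]] := neighbours_exist gE.
elim: N => [|N [D uD DE]].
  exists [:: x] => // n t y; rewrite leqn0 => /eqP -> t0; rewrite inE => yx.
  by rewrite arrived0// eq_sym (negPf yx).
exists (undup (D ++ flatten (map nb D))); first exact: undup_uniq.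
move=> n t y; rewrite mem_undup mem_cat negb_or leq_eqVlt => nN t0 /andP[yD yf].
case/orP: nN => [/eqP ->|nN]; last exact: DE.
rewrite (@arrivedS _ _ _ _ (nb y)) => //; last first.
  by move=> z zy; rewrite -nbE (graph_sym gE).
rewrite big_seq big1// => z zy.
have zD : z \notin D.
  apply: contra yf => zD; apply/flattenP; exists (nb z); first exact: map_f.
  by rewrite -nbE (graph_sym gE) nbE.
have := DE N t z (leqnn _) t0 zD; rewrite arrivedE => /eqP.
rewrite paddr_eq0 ?fine_ge0// => /andP[_ /eqP ->]; exact: mulr0.
Qed.

Lemma walk_expansion : jump_expansion nu mu q jumps.
Proof.
split.
- by move=> x n t y; exact: fine_ge0.
- move=> x N; have [D uD DE] := arrived_support x N.
  exists D => // n t y nN yD; rewrite jumpsE.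
  have t0 : 0 <= Num.max t 0 by rewrite le_max lexx orbT.
  have := DE n _ y nN t0 yD; rewrite arrivedE => /eqP.
  by rewrite paddr_eq0 ?fine_ge0// => /andP[/eqP -> /eqP ->]; rewrite addr0 subr0.
- exact: jumps_start.
- exact: jumps_continuous.
- exact: jumps_derive.
Qed.

(** * Transition probabilities of the walk *)

Lemma jump_timeE n w : jump_time nu mu Y H n w = (arrival n w)%:E.
Proof.
rewrite /jump_time /arrival -sumEFin; apply: eq_bigr => k _.
by rewrite /holding_time inver gt_eqF.
Qed.

(** At time t the walk stands at y exactly when some holding interval of a visit
    to y contains t. *)
Lemma walk_event t y : 0 <= t -> [set w | X t w = Some y] =
  \bigcup_n [set w | (arrival n w <= t /\ t < arrival n.+1 w) /\ Y n w = y].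
Proof.
move=> t0; apply/seteqP; split => w /=.
  move=> /(minwalk_path walk w y t0) [n]; rewrite !jump_timeE => -[h1 h2 h3].
  by exists n => //=; rewrite -lee_fin -lte_fin.
move=> [n _ /= [[h1 h2] h3]]; apply/(minwalk_path walk w y t0); exists n.
by rewrite !jump_timeE lee_fin lte_fin.
Qed.

Lemma walk_probability x t y : 0 <= t ->
  P x [set w | X t w = Some y] = (\sum_(n <oo) (jumps x n t y)%:E)%E.
Proof.
move=> t0; rewrite walk_event// measure_semi_bigcup.
- apply: eq_eseriesr => n _; rewrite /jumps max_l// /occupied.
  by rewrite -probabilityE.
- by move=> n; exact: mocc.
- have mono m n w : (m < n)%N -> arrival m.+1 w <= arrival n w.
    elim: n => [//|n IH]; rewrite ltnS leq_eqVlt => /orP[/eqP -> //|/IH h].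
    by apply: (le_trans h); exact/ltW/arrival_ltS.
  apply/trivIsetP => m n _ _; rewrite neq_ltn => mn.
  apply/seteqP; split => // w /= [[[h1 h2] _] [[h3 h4] _]].
  case/orP: mn => /(mono _ _ w) h.
    by move: (lt_le_trans h2 (le_trans h h3)); rewrite ltxx.
  by move: (lt_le_trans h4 (le_trans h h1)); rewrite ltxx.
- by apply: bigcupT_measurable => n; exact: mocc.
Qed.

Lemma partial_heat_le_walk x t y N : 0 <= t ->
  ((partial_heat jumps N x t y)%:E <= P x [set w | X t w = Some y])%E.
Proof.
move=> t0; rewrite walk_probability// /partial_heat -sumEFin -(big_mkord xpredT (fun n => (jumps x n t y)%:E)).
apply: nneseries_lim_ge => n _ _; rewrite lee_fin; exact: fine_ge0.
Qed.

Lemma walk_le_of_partial_heat x t y b : 0 <= t ->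
  (forall N, partial_heat jumps N x t y <= b) ->
  (P x [set w | X t w = Some y] <= b%:E)%E.
Proof.
move=> t0 hb; rewrite walk_probability//; apply: lime_le.
  by apply: is_cvg_nneseries => n _ _; rewrite lee_fin; exact: fine_ge0.
near=> n; rewrite big_mkord sumEFin lee_fin.
apply: le_trans (hb n); rewrite /partial_heat big_ord_recr/= lerDl.
exact: fine_ge0.
Unshelve. all: by end_near. Qed.

End walk.

(** * The Gaussian upper bound *)

Unset Implicit Arguments.

Theorem theorem5p1 (R : realType) (A gamma delta epsilon : R)
    (hA : 1 <= A) (hgamma : 1 < gamma) (hdelta : 0 <= delta)
    (hepsilon0 : 0 <= epsilon) (hepsilon1 : epsilon < 1) :
  exists2 C1 : R, 0 < C1 &
  forall (V : choiceType) (E : rel V) (mu : V -> V -> R) (nu : V -> R)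
    (d : V -> V -> R) (disp : measure_display) (Om : measurableType disp)
    (P : V -> probability Om R) (X : R -> Om -> option V),
  graph E -> edge_weight E mu -> (forall x, 0 < nu x) ->
  adapted_metric E nu mu d -> minimal_walk nu mu P X ->
  forall (T1 : R) (T2 : \bar R) (x1 x2 : V) (f1 f2 : R -> R),
  0 <= T1 -> (T1%:E < T2)%E ->
  (forall t, 0 <= t -> (P x1 [set w | X t w = Some x1] <= (f1 t)%:E^-1)%E) ->
  (forall t, 0 <= t -> (P x2 [set w | X t w = Some x2] <= (f2 t)%:E^-1)%E) ->
  regular A gamma T1 T2 f1 -> regular A gamma T1 T2 f2 ->
  (forall t, T1 <= t -> (t%:E < T2)%E ->
     f1 t <= A * expR (delta * t `^ epsilon)) ->
  (forall t, T1 <= t -> (t%:E < T2)%E ->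
     f2 t <= A * expR (delta * t `^ epsilon)) ->
  forall t : R,
  Num.max (2 ^+ 9 * delta * T1 `^ (1 + epsilon)) (d x1 x2) <= t ->
  (t%:E < T2)%E -> 0 < t ->
  (P x1 [set w | X t w = Some x2] <=
   (C1 * (nu x2 / nu x1) `^ (1 / 2) /
    Num.sqrt (f1 (t / (2 * gamma)) * f2 (t / (2 * gamma))) *
    expR (- (10 ^- 7 * (d x1 x2 ^+ 2 / t))))%:E)%E.
Proof.
have u0 : 0 < 8 * 10 ^- 7 :> R by rewrite mulr_gt0// invr_gt0 exprn_gt0.
have u1 : 8 * 10 ^- 7 <= 1600^-1 :> R by lra.
have [C C0 tail] := tail_decay hA hgamma hdelta hepsilon0 hepsilon1 u0 u1.
have s0 : 0 <= Num.sqrt C by exact: sqrtr_ge0.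
(* The summand 1 serves the case x1 = x2. *)
exists (2 * Num.sqrt C + 1) => [|V E mu nu d disp Om P X gE mE nu0 ad [Y [H walk]]
  T1 T2 x1 x2 f1 f2 T10 T12 diag1 diag2 reg1 reg2 grow1 grow2 t]; first by lra.
rewrite ge_max => /andP[tT1 dt] tT2 t0.
have [_ f1_gt0 f1_nd _] := reg1; have [_ f2_gt0 f2_nd _] := reg2.
have g0 : 0 < gamma by lra.
have tg0 : 0 < t / (2 * gamma) by rewrite divr_gt0// mulr_gt0.
have tgt : t / (2 * gamma) <= t by rewrite ler_pdivrMr ?mulr_gt0// ler_pMr//; lra.
have F1 := f1_gt0 _ tg0; have F2 := f2_gt0 _ tg0.
have [ad_metric _ ad_jump] := ad.
have [d_ge0 d_eq0 d_sym d_tri] := ad_metric.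
have inv_fin (f : R -> R) s : (forall s, 0 < s -> 0 < f s) -> 0 < s ->
    ((f s)%:E^-1 = (f s)^-1%:E)%E.
  by move=> f_gt0 sp; rewrite inver gt_eqF// f_gt0.
rewrite div1r powR12_sqrt; last by rewrite divr_ge0// ltW.
(* If x1 = x2 the two on-diagonal bounds give the claim directly; the exit rate of
   a single vertex without edges is 0, so this case is kept apart. *)
have [x12|x12] := eqVneq x1 x2.
  subst x2; rewrite divff ?gt_eqF// sqrtr1 mulr1.
  have -> : d x1 x1 = 0 by apply/d_eq0.
  rewrite expr0n/= mul0r mulr0 oppr0 expR0 mulr1.
  have h1 := diag1 t (ltW t0); have h2 := diag2 t (ltW t0).
  rewrite inv_fin// in h1; rewrite inv_fin// in h2.
  have fin : P x1 [set w | X t w = Some x1] \is a fin_num.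
    by rewrite ge0_fin_numE// (le_lt_trans h1)// ltry.
  move: h1 h2; rewrite -(fineK fin) !lee_fin; set p := fine _ => h1 h2.
  have p0 : 0 <= p by exact: fine_ge0.
  have bound f : (forall s, 0 < s -> 0 < f s) ->
      (forall s t, 0 <= s -> s <= t -> f s <= f t) -> p <= (f t)^-1 ->
      p <= (f (t / (2 * gamma)))^-1.
    move=> f_gt0 f_nd h; apply: (le_trans h).
    by rewrite lef_pV2 ?posrE ?f_gt0// f_nd// ltW.
  have {}h1 := bound _ f1_gt0 f1_nd h1; have {}h2 := bound _ f2_gt0 f2_nd h2.
  set g := f1 _ * f2 _; have gg0 : 0 < g by exact: mulr_gt0.
  have sg0 : 0 < Num.sqrt g by rewrite sqrtr_gt0.
  apply: (@le_trans _ _ (Num.sqrt g)^-1); last first.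
    by apply: ler_peMl; [rewrite invr_ge0 ltW|lra].
  rewrite -sqrtrV ?(ltW gg0)// -[p]ger0_norm// -sqrtr_sqr ler_wsqrtr//.
  by rewrite expr2 /g invfM; apply: ler_pM.
have gt0_rate z : 0 < exit_rate nu mu z.
  have [->|zx] := eqVneq z x1; first exact: (exit_rate_gt0 gE mE nu0 x12).
  exact: (exit_rate_gt0 gE mE nu0 zx).
have cV := vertices_countable gE.
have J0 := jump_prob_ge0 gE mE nu0.
have jp := walk_expansion walk cV gt0_rate J0 gE mE.
have d12 : 0 < d x1 x2.
  rewrite lt_neqAle d_ge0 andbT eq_sym; apply/eqP => /d_eq0 e.
  by rewrite e eqxx in x12.
have diag x f : (forall s, 0 < s -> 0 < f s) ->
    (forall t, 0 <= t -> (P x [set w | X t w = Some x] <= (f t)%:E^-1)%E) ->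
    forall s n, 0 < s -> partial_heat (jumps nu mu P Y H) n x s x <= (f s)^-1.
  move=> f_gt0 h s n sp; rewrite -lee_fin -inv_fin//.
  apply: le_trans (h s (ltW sp)).
  exact: (partial_heat_le_walk walk cV gt0_rate x x n (ltW sp)).
apply: (walk_le_of_partial_heat walk cV gt0_rate (ltW t0)) => N.
have mu_pos x y : 0 < mu x y -> d x y <= 1.
  move=> mp; apply: ad_jump; apply/negPn/negP => /(edge_weight_eq0 mE) m0.
  by rewrite m0 ltxx in mp.
have d_refl x : d x x = 0 by apply/d_eq0.
have main := expansion_gaussian_bound nu0 (edge_weight_sym mE) jp
  (edge_weight_ge0 mE) d_sym mu_pos (fun x D => @adapted_sum_le _ _ _ _ _ gE mE nu0 d x D ad)
  (exit_rate_ge_sum gE mE nu0) d_ge0 d_refl d_tri hgamma tail C0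
  N x12 d12 T10 T12 (diag _ _ f1_gt0 diag1) (diag _ _ f2_gt0 diag2)
  reg1 reg2 grow1 grow2 tT1 dt tT2 t0.
apply: (le_trans main); rewrite ler_wpM2r ?expR_ge0// ler_wpM2r ?invr_ge0 ?sqrtr_ge0//.
by rewrite ler_wpM2r ?sqrtr_ge0//; lra.
Qed.
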